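(* Let $N_0$ be a real skew-symmetric $n\times n$ matrix with simple spectrum and $S_0$ a real symmetric $n\times n$ matrix. (a) The coadjoint orbit $\mathcal{O}_{S_0+zN_0}$ of $\widetilde G$ through $S_0+zN_0$ is a $2[n^2/4]$-dimensional affine linear space, equal to $$\{S+zN\ :\ S\text{ real symmetric},\ N=N_0,\ \operatorname{tr}(SN^\ell)=\operatorname{tr}(S_0N_0^\ell)\text{ for all even }\ell\text{ with }0\le\ell\le n-1\}.$$ (b) For $1\le k\le n$ and $\ell\in\mathbb{Z}$, on loops $S+zN$ ($S$ symmetric, $N$ skew-symmetric) the equation of motion of the Hamiltonian $H_{k\ell}$ is $$\dot S=[\mathrm{sym}_{k-(\ell+1),\ell+1}(S,N),S]=-[\mathrm{sym}_{k-\ell,\ell}(S,N),N],\qquad \dot N=0.$$ Moreover the Hamiltonians $H_{k\ell}$ with $1\le k\le n-1$, $\ell$ even, $0\le\ell\le\min(k-1,n-2)$ are generically independent on $\mathcal{O}_{S_0+zN_0}$ and provide $[n^2/4]$ Poisson-commuting integrals.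
   Context: $[x]$ denotes the integer part of $x$. $\mathrm{sym}_{ij}(A,B)$ is the sum of all distinct words in $A,B$ with $i$ letters $A$ and $j$ letters $B$, and is taken to be $0$ if $i<0$ or $j<0$. $LG^{\Sigma}$ is the group of smooth loops $g:S^1\to GL(n,\mathbb{C})$ with $\overline{g(z)}=g(\bar z)$ and $g(z)g(-z)^T=I$; $LG^{\Sigma}_+$ (resp. $LG^{\Sigma}_-$) are those extending analytically inside (resp. outside) the unit circle, with $g(\infty)=I$ for $LG^\Sigma_-$; $\widetilde G=\{g=g_+g_-^{-1}: g_\pm\in LG^{\Sigma}_\pm\}$ (unique factors). $L\mathfrak{g}^{\sigma}$ (resp. $L\mathfrak{g}^{\sigma^*}$) is the space of real loops $\sum_jX_jz^j$ with $X_{2j}$ skew and $X_{2j+1}$ symmetric (resp. $X_{2j}$ symmetric, $X_{2j+1}$ skew); $\Pi_\pm$ project onto the $j\ge0$, resp. $j<0$, parts. Coadjoint action: $\mathrm{Ad}^*_{\widetilde G}(g)A=\Pi_-(g_+^{-1}Ag_+)+\Pi_+(g_-^{-1}Ag_-)$. Pairing $(X,Y)=\oint_{|z|=1}\operatorname{tr}(XY)\frac{dz}{2\pi i}$; bracket $[X,Y]_R=[\Pi_+X,\Pi_+Y]-[\Pi_-X,\Pi_-Y]$ on $L\mathfrak g^\sigma$; Lie–Poisson bracket $\{F_1,F_2\}(X)=(X,[dF_1(X),dF_2(X)]_R)$, $dF(X)\in L\mathfrak{g}^\sigma$ defined via the pairing; Hamiltonian flows $\dot F=\{F,H\}$. $H_{k\ell}(X)=\frac1{k+1}\oint_{|z|=1}\operatorname{tr}(X(z)^{k+1})\frac{dz}{2\pi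 iz^{\ell+1}}$.
   Formalization: In (b) the equation of motion is proved only for even ℓ: for odd ℓ the Hamiltonian H_{kℓ} vanishes identically on these loops while the stated right-hand side, e.g. [N²,S] for k=2, ℓ=1, n=3, is generally nonzero. The equality of the two commutators is proved for all ℓ. *)

(* Defs.v *)
From HB Require Import structures.
From mathcomp Require Import all_boot all_order all_algebra.
From mathcomp Require Import separable.
From mathcomp Require Import boolp classical_sets reals topology normedtype derive.
Set Implicit Arguments. Unset Strict Implicit. Unset Printing Implicit Defensive.
Import Order.TTheory GRing.Theory Num.Theory.
Import numFieldNormedType.Exports.
Local Open Scope ring_scope.
Local Open Scope classical_set_scope.

Section LoopDefs.
Variable R : realType.
Variable n : nat.
Local Notation M := 'M[R]_n.

(* A loop X(z) = \sum_j X_j z^j is represented by its (real) Fourier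
   coefficient function j |-> X_j. *)
Definition loop := int -> M.

Definition mk_loop (S N : M) : loop :=
  fun j => if j == 0 then S else if j == 1 then N else 0.

Definition in_dual (X : loop) := forall j : int,
  (X j)^T = (if odd (absz j) then - X j else X j).
Definition in_alg (X : loop) := forall j : int,
  (X j)^T = (if odd (absz j) then X j else - X j).

Definition supp_in (K : nat) (X : loop) := forall j : int, (K < absz j)%N -> X j = 0.

Definition sidx (K : nat) (i : 'I_(K.*2.+1)) : int := (i%:Z - K%:Z)%R.

(* product of loops, exact whenever X is supported in [-K,K] *)
Definition lmul (K : nat) (X Y : loop) : loop :=
  fun j => \sum_(i < K.*2.+1) X (sidx i) *m Y (j - sidx i).
Definition lunit : loop := fun j => if j == 0 then 1%:M else 0.
Fixpoint lpow (K : nat) (X : loop) (k : nat) : loop :=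
  match k with 0%N => lunit | k'.+1 => lmul K X (lpow K X k') end.
Definition lcomm (K : nat) (X Y : loop) : loop :=
  fun j => lmul K X Y j - lmul K Y X j.

(* pairing (X,Y) = \oint tr(XY) dz/(2 pi i) = \sum_j tr(X_j Y_{-1-j}),
   exact whenever X is supported in [-K,K] *)
Definition lpair (K : nat) (X Y : loop) : R :=
  \sum_(i < K.*2.+1) \tr (X (sidx i) *m Y (-1 - sidx i)).

Definition pplus (X : loop) : loop := fun j => if (0 <= j)%R then X j else 0.
Definition pminus (X : loop) : loop := fun j => if (j < 0)%R then X j else 0.

Definition lbrR (K : nat) (X Y : loop) : loop :=
  fun j => lcomm K (pplus X) (pplus Y) j - lcomm K (pminus X) (pminus Y) j.

(* H_{k l}(X) = 1/(k+1) \oint tr(X^{k+1}) dz/(2 pi i z^{l+1})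
             = 1/(k+1) tr (coefficient of z^l in X^{k+1}) *)
Definition Hkl (k : nat) (l : int) (K : nat) (X : loop) : R :=
  (k.+1%:R)^-1 * \tr (lpow K X k.+1 l).

(* W = dF(X) in L g^sigma, defined via the pairing: d/de F(X + e Y') at e = 0
   equals (Y', W) for every (finitely supported) Y' in L g^{sigma*}.
   F K is the functional evaluated with support bound K; X supported in KX. *)
Definition is_grad (KX : nat) (F : nat -> loop -> R) (X W : loop) :=
  [/\ in_alg W, exists KW, supp_in KW W &
      forall (K : nat) (Y' : loop), (KX <= K)%N -> supp_in K Y' -> in_dual Y' ->
        is_derive (0 : R) (1 : R) (fun e : R => F K (fun j => X j + e *: Y' j))
                  (lpair K Y' W)].

(* V is the Hamiltonian vector field of F at X for the Lie--Poisson bracket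
   {F1,F2}(X) = (X, [dF1(X), dF2(X)]_R): for every linear function
   F_Y = (., Y), Y in L g^sigma, one has d/dt F_Y = (V, Y) = {F_Y, F}(X). *)
Definition is_hamvf (KX : nat) (F : nat -> loop -> R) (X V : loop) :=
  [/\ in_dual V, exists KV, supp_in KV V &
      exists W, is_grad KX F X W /\
        forall (K : nat) (Y : loop), (KX <= K)%N -> supp_in K V -> supp_in K W ->
          supp_in K Y -> in_alg Y -> lpair K V Y = lpair K X (lbrR K Y W)].

(* power series (in z for LG_+, in z^{-1} for LG_-) *)
Definition pser := nat -> M.
Definition convp (a b : pser) : pser :=
  fun m => \sum_(i < m.+1) a i *m b (m - i)%N.
Definition pdelta : pser := fun m => if m == 0%N then 1%:M else 0.
(* rapidly decreasing coefficients <=> smooth loop *)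
Definition rapid (a : pser) :=
  forall p : nat, exists C : R, forall (j : nat) (i i' : 'I_n), `|a j i i'| * (j%:R) ^+ p <= C.
(* g(z) g(-z)^T = I *)
Definition twisted_orth (a : pser) :=
  forall m : nat, \sum_(i < m.+1) ((-1) ^+ (m - i)%N) *: (a i *m (a (m - i)%N)^T) = pdelta m.
(* LG^Sigma_+ : real smooth loops extending analytically inside the circle *)
Definition LGplus (a : pser) := rapid a /\ twisted_orth a.
(* LG^Sigma_- : coefficients of z^{-j}, g(infinity) = I *)
Definition LGminus (b : pser) := [/\ rapid b, b 0%N = 1%:M & twisted_orth b].
Definition pinv (a b : pser) := convp a b = pdelta /\ convp b a = pdelta.

(* Ad^*(g_+ g_-^{-1}) (S0 + z N0)
     = Pi_-(g_+^{-1} A g_+) + Pi_+(g_-^{-1} A g_-) *)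
Definition Aplus (S0 N0 : M) : pser :=
  fun m => if m == 0%N then S0 else if m == 1%N then N0 else 0.
(* A = z (N0 + z^{-1} S0) *)
Definition Aminus (S0 N0 : M) : pser :=
  fun m => if m == 0%N then N0 else if m == 1%N then S0 else 0.
Definition plusloop (c : pser) : loop :=
  fun j => if (0 <= j)%R then c (absz j) else 0.
(* z * \sum_m c_m z^{-m} *)
Definition minusloop1 (c : pser) : loop :=
  fun j => if (j <= 1)%R then c (absz (1 - j)) else 0.
Definition coad (S0 N0 : M) (gp hp gm hm : pser) : loop :=
  fun j => pminus (plusloop (convp (convp hp (Aplus S0 N0)) gp)) j
         + pplus (minusloop1 (convp (convp hm (Aminus S0 N0)) gm)) j.

Definition coadj_orbit (S0 N0 : M) : set loop :=
  [set X | exists gp hp gm hm, [/\ LGplus gp, pinv gp hp, LGminus gm, pinv gm hm &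
                                 X = coad S0 N0 gp hp gm hm]].

Definition simple_spectrum (N : M) := separable_poly (char_poly N).

Definition orbit_aff (S0 N0 : M) : set M :=
  [set S | S^T = S /\ forall l : nat, ~~ odd l -> (l <= n.-1)%N ->
             \tr (S *m N0 ^+ l) = \tr (S0 *m N0 ^+ l)].

Definition mcomm (A B : M) : M := A *m B - B *m A.

Definition symw (i j : nat) (A B : M) : M :=
  \sum_(w : (i + j).-tuple bool | count id w == j)
     foldr (fun b P => (if b then B else A) *m P) 1%:M w.
Definition symz (i j : int) (A B : M) : M :=
  match i, j with Posz a, Posz b => symw a b A B | _, _ => 0 end.

Definition idxs : seq (nat * nat) :=
  [seq (k, l) | k <- iota 1 n.-1,
                l <- [seq l <- iota 0 (minn k.-1 n.-2).+1 | ~~ odd l]].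

Definition dH_orbit (N0 : M) (p : nat * nat) (S D : M) : R :=
  derive1 (fun e : R => Hkl p.1 p.2%:Z 1 (mk_loop (S + e *: D) N0)) 0.

Definition orbit_tangent (S0 N0 S D : M) :=
  forall e : R, coadj_orbit S0 N0 (mk_loop (S + e *: D) N0).

Definition indep_at (S0 N0 S : M) :=
  forall c : nat * nat -> R,
    (forall D, orbit_tangent S0 N0 S D -> \sum_(p <- idxs) c p * dH_orbit N0 p S D = 0) ->
    forall p, p \in idxs -> c p = 0.

End LoopDefs.

(* Main.v *)
Require Import Defs.
From HB Require Import structures.
From mathcomp Require Import all_boot all_order all_algebra.
From mathcomp Require Import separable complex zify ring lra.
From mathcomp Require Import boolp classical_sets reals topology normedtype sequences derive exp.
Import Order.TTheory GRing.Theory Num.Theory.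
Import numFieldNormedType.Exports.
Local Open Scope ring_scope.
Local Open Scope classical_set_scope.
Set Implicit Arguments. Unset Strict Implicit. Unset Printing Implicit Defensive.

(** The coefficient P_{k,l} of z^l in (S + zN)^k satisfies
    [P_{k,l+1}, S] = - [P_{k,l}, N].  It is, up to an index shift, a coefficient of the
    gradient of H_{k,l}, so this identity gives the equations of motion, and applied
    repeatedly it gives involutivity.

    Only g_{-,1} enters the coadjoint action on S0 + z N0, which therefore moves S0 by
    [N0, b] with b symmetric; b is arbitrary because exp(b/z) lies in the group.
    Diagonalising N0 over C identifies {[N0, b]} with the symmetric matrices orthogonal
    to the even powers of N0.

    Hence the H_{k,l} are independent along the orbit at S iff the P_{k,l} with l even
    and l <= k < n (the case k = l being the powers of N0) are linearly independent.  By
    polynomiality in S it is enough to have this for one direction D tangent to the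
    orbit, first over C.  In an eigenbasis of N0 ordered so that the eigenvalues are
    negated by reversal, a suitably weighted shift is symmetric and tangent; there the
    P_{k,l} are graded by the superdiagonal k - l, and the identity above reduces the
    i+1-st superdiagonal to the i-th, down to a Vandermonde determinant. *)

(** * Sums of words in two noncommuting letters *)

Section NoncommutativeSymmetric.
Variable T : pzRingType.
Implicit Types x y : T.

(* The sum of all words with k - l letters x and l letters y, that is, the
   coefficient of z^l in (x + z y)^k. *)
Fixpoint psym x y (k l : nat) : T :=
  if k is k'.+1 then
    x * psym x y k' l + (if l is l'.+1 then y * psym x y k' l' else 0)
  else (l == 0%N)%:R.

Lemma psymS0 x y k : psym x y k.+1 0 = x * psym x y k 0.
Proof. by rewrite /= addr0. Qed.

Lemma psymSS x y k l :
  psym x y k.+1 l.+1 = x * psym x y k l.+1 + y * psym x y k l.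
Proof. by []. Qed.

Lemma psym0 x y k : psym x y k 0 = x ^+ k.
Proof. by elim: k => [|k IH]; rewrite ?expr0 // psymS0 IH exprS. Qed.

Lemma psym_small x y k l : (k < l)%N -> psym x y k l = 0.
Proof.
elim: k l => [|k IH] [|l] //= lt_kl.
by rewrite !IH ?mulr0 ?addr0 // ltnW.
Qed.

Lemma psym_diag x y k : psym x y k k = y ^+ k.
Proof.
elim: k => [|k IH]; first by rewrite expr0.
by rewrite psymSS IH psym_small // mulr0 add0r exprS.
Qed.

(** Words are split at their last letter instead of their first; expanding at both ends gives the
    same sum, by induction on the length. *)
Lemma psymSSr x y k l :
  psym x y k.+1 l.+1 = psym x y k l.+1 * x + psym x y k l * y.
Proof.
elim: k l => [|k IH] l.
  by case: l => [|l] /=; rewrite ?(mulr0, mul0r, mulr1, mul1r).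
rewrite psymSS [in LHS]IH mulrDr; case: l => [|l].
  rewrite (psymSS x y k 0) !psym0 mulrDl !mulrA addrAC.
  by rewrite -(mulrA y) -exprSr -exprS.
rewrite [in LHS]IH (psymSS x y k l.+1) (psymSS x y k l) mulrDr !mulrDl !mulrA.
by rewrite addrACA.
Qed.

(* Both sides come from expanding psym k.+1 l.+1 on the left and on the right. *)
Lemma psym_comm x y k l :
  psym x y k l.+1 * x - x * psym x y k l.+1
    = - (psym x y k l * y - y * psym x y k l).
Proof.
have := psymSSr x y k l; rewrite psymSS => e.
rewrite opprB; apply/eqP.
by rewrite subr_eq addrAC eq_sym subr_eq eq_sym -e addrC.
Qed.

End NoncommutativeSymmetric.

(** Stated for a bare function so that it serves both [map_mx] and conjugation by a unit matrix. *)
Lemma psym_morph (T T' : pzRingType) (f : T -> T') (x y : T) k l :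
  f 0 = 0 -> f 1 = 1 -> {morph f : a b / a + b} -> {morph f : a b / a * b} ->
  f (psym x y k l) = psym (f x) (f y) k l.
Proof.
move=> f0 f1 fD fM; elim: k l => [|k IH] [|l] //=.
  by rewrite fD fM IH f0.
by rewrite fD !fM !IH.
Qed.

Lemma psym_map (A B : pzRingType) (f : {rmorphism A -> B}) n (S N : 'M[A]_n) k l :
  map_mx f (psym S N k l) = psym (map_mx f S) (map_mx f N) k l.
Proof.
apply: psym_morph => [|||] /=; first exact: map_mx0.
- exact: map_mx1.
- exact: map_mxD.
- exact: map_mxM.
Qed.

Lemma mulr_mx (A : pzRingType) n (X Y : 'M[A]_n) : X * Y = X *m Y.
Proof. by []. Qed.

Lemma psym_tr (A : comPzRingType) n (S N : 'M[A]_n) k l :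
  S^T = S -> N^T = - N -> (psym S N k l)^T = (-1) ^+ l *: psym S N k l.
Proof.
move=> eS eN; elim: k l => [|k IH] [|l]; first by rewrite /= trmx1 scale1r.
- by rewrite /= trmx0 scaler0.
- have := IH 0%N; rewrite !psym0 expr0 !scale1r => e.
  by rewrite [RHS]exprS exprSr trmx_mul e eS.
rewrite psymSSr raddfD /= !trmx_mul !IH eS eN.
rewrite -!scalemxAr mulNmx -psymSSr psymSS scalerDr; congr (_ + _).
by rewrite scalerN exprS mulN1r scaleNr.
Qed.

(** The truncated exponent [k - l] is harmless: for [l > k] both sides vanish. *)
Lemma psym_scale (A : comPzRingType) n (c : A) (S N : 'M[A]_n) k l :
  psym (c *: S) N k l = c ^+ (k - l) *: psym S N k l.
Proof.
elim: k l => [|k IH] [|l].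
- by rewrite scale1r.
- by rewrite /= scaler0.
- by rewrite !psymS0 IH !subn0 !mulr_mx -scalemxAl -scalemxAr scalerA exprS.
rewrite !psymSS !IH subSS !mulr_mx -scalemxAl -!scalemxAr scalerA scalerDr.
case: (leqP l.+1 k) => [lt_lk|le_kl]; last first.
  by rewrite (psym_small S N le_kl) mulmx0 !scaler0.
by rewrite -exprS -subSn.
Qed.

Lemma psym_conj (F : fieldType) n (P S N : 'M[F]_n) k l : P \in unitmx ->
  psym (invmx P *m S *m P) (invmx P *m N *m P) k l
    = invmx P *m psym S N k l *m P.
Proof.
move=> uP; rewrite [RHS](psym_morph (f := fun Z => invmx P *m Z *m P)) //.
- by rewrite mulmx0 mul0mx.
- by rewrite mulmx1 mulVmx.
- by move=> a b; rewrite mulmxDr mulmxDl.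
by move=> a b; rewrite !mulr_mx -!mulmxA mulKVmx.
Qed.

(** * Free families of matrices and their annihilators under the trace form *)

Lemma big_enum_val_ord (V : zmodType) (I : finType) (f : I -> V) :
  \sum_(i < #|I|) f (enum_val i) = \sum_i f i.
Proof.
rewrite [RHS](reindex (@enum_val I I)) //.
exact/onW_bij/enum_val_bij.
Qed.

(** Turns the trace form into a row-by-column product, so that rank arguments apply to families of
    matrices. *)
Lemma mxtrace_mxvec (A : comPzRingType) n (D Q : 'M[A]_n) :
  \tr (D *m Q) = (mxvec Q *m (mxvec D^T)^T) 0 0.
Proof.
rewrite mxE (reindex _ (curry_mxvec_bij n n)) /=.
transitivity (\sum_i \sum_j D i j * Q j i).
  by apply: eq_bigr => i _; rewrite mxE.
rewrite exchange_big pair_bigA; apply: eq_bigr => -[i j] _ /=.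
by rewrite mxE !mxvecE mxE mulrC.
Qed.

Definition family_mx (A : pzRingType) (I : finType) n (X : I -> 'M[A]_n) :
  'M[A]_(#|I|, n * n) := \matrix_(i < #|I|) mxvec (X (enum_val i)).

(** As a rank condition, freeness is invariant under field extension and is witnessed by a right
    inverse, hence by a nonzero determinant that varies polynomially or continuously with the
    family. *)
Definition mxfree (F : fieldType) (I : finType) n (X : I -> 'M[F]_n) :=
  row_free (family_mx X).

Lemma family_mx_comb (A : comPzRingType) (I : finType) n (X : I -> 'M[A]_n)
    (c : I -> A) :
  (\row_(i < #|I|) c (enum_val i)) *m family_mx X = mxvec (\sum_i c i *: X i).
Proof.
rewrite mulmx_sum_row -[in RHS]big_enum_val_ord linear_sum; apply: eq_bigr => i _ /=.
by rewrite rowK linearZ mxE.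
Qed.

Lemma map_family_mx (A B : pzRingType) (f : {rmorphism A -> B}) (I : finType) n
    (X : I -> 'M[A]_n) :
  map_mx f (family_mx X) = family_mx (fun i => map_mx f (X i)).
Proof.
apply/matrixP => i j; rewrite !mxE; case/mxvec_indexP: j => a b.
by rewrite !mxvecE mxE.
Qed.

Section FreeFamilies.
Variables (F : fieldType) (I : finType) (n : nat).
Implicit Types (X : I -> 'M[F]_n) (D Q : 'M[F]_n).

Lemma mxfreeP X :
  mxfree X <-> (forall c : I -> F, \sum_i c i *: X i = 0 -> forall i, c i = 0).
Proof.
split=> [frX c c0 i|H].
  have := family_mx_comb X c; rewrite c0 linear0 -(mul0mx 1 (family_mx X)).
  move/(row_free_inj frX)/rowP/(_ (enum_rank i)).
  by rewrite !mxE enum_rankK.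
rewrite /mxfree -kermx_eq0; apply/rowV0P => u /sub_kermxP u0.
pose c i := u 0 (enum_rank i).
have eu : u = \row_i c (enum_val i).
  by apply/rowP => i; rewrite mxE /c enum_valK.
move: u0; rewrite eu family_mx_comb -(linear0 (@mxvec F n n)).
move/(can_inj mxvecK)/H => c0.
by apply/rowP => i; rewrite !mxE c0.
Qed.

Lemma mxfree_map (F' : fieldType) (f : {rmorphism F -> F'}) X :
  mxfree (fun i => map_mx f (X i)) = mxfree X.
Proof. by rewrite /mxfree -map_family_mx row_free_map. Qed.

(* Witness: the determinant of the polynomial family times a right inverse of
   its value at t0. *)
Lemma mxfree_horner (X : I -> 'M[{poly F}]_n) (t0 : F) :
  mxfree (fun i => map_mx (horner_eval t0) (X i)) ->
  exists2 q : {poly F}, q != 0 &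
    forall t, ~~ root q t -> mxfree (fun i => map_mx (horner_eval t) (X i)).
Proof.
rewrite /mxfree -map_family_mx => /row_freeP[B eB].
have ev t : (\det (family_mx X *m map_mx polyC B)).[t]
    = \det (map_mx (horner_eval t) (family_mx X) *m B).
  rewrite -horner_evalE -det_map_mx map_mxM; congr (\det (_ *m _)).
  by apply/matrixP => i j; rewrite !mxE /= /horner_eval hornerC.
exists (\det (family_mx X *m map_mx polyC B)) => [|t].
  apply/eqP => /(congr1 (horner^~ t0)); rewrite ev eB det1 horner0 => /eqP.
  by rewrite oner_eq0.
rewrite rootE ev -map_family_mx -unitfE -unitmxE => uAB.
apply/row_freeP; exists (B *m invmx (map_mx (horner_eval t) (family_mx X) *m B)).
by rewrite mulmxA mulmxV.
Qed.

Lemma mx_biorthogonal X Q :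
  (forall D, (forall i, \tr (D *m X i) = 0) -> \tr (D *m Q) = 0) ->
  exists c : I -> F, Q = \sum_i c i *: X i.
Proof.
move=> H; have : (mxvec Q <= family_mx X)%MS.
  rewrite submxE; apply/eqP/rowP => j; rewrite [RHS]mxE.
  (* Column [j] of the cokernel, folded back into a matrix, computes coordinate [j] of
     [mxvec Z *m cokermx _] as a trace against [Z]. *)
  pose D := (vec_mx (col j (cokermx (family_mx X)))^T)^T.
  have eD Z : \tr (D *m Z) = (mxvec Z *m cokermx (family_mx X)) 0 j.
    rewrite mxtrace_mxvec /D trmxK vec_mxK trmxK !mxE.
    by apply: eq_bigr => k _; rewrite !mxE.
  rewrite -eD; apply: H => i; rewrite eD.
  transitivity ((family_mx X *m cokermx (family_mx X)) (enum_rank i) j).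
    rewrite mxE [RHS]mxE; apply: eq_bigr => k _; congr (_ * _).
    by rewrite mxE enum_rankK.
  by rewrite mulmx_coker mxE.
case/submxP => u eu; exists (fun i => u 0 (enum_rank i)).
apply: (can_inj mxvecK); rewrite -family_mx_comb eu; congr (_ *m _).
by apply/rowP => i; rewrite mxE enum_valK.
Qed.

Lemma mx_annihilator X : mxfree X ->
  exists2 V : {vspace 'M[F]_n}, (\dim V + #|I| = n * n)%N &
    forall D, D \in V <-> forall i, \tr (D *m X i) = 0.
Proof.
move=> frX.
pose f D : 'rV[F]_#|I| := \row_i \tr (D *m X (enum_val i)).
have f_lin : linear f.
  move=> a A B; apply/rowP => i.
  by rewrite !mxE mulmxDl -scalemxAl linearD linearZ.
pose f' : {linear 'M[F]_n -> 'rV[F]_#|I|} :=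
  HB.pack f (GRing.isLinear.Build _ _ _ _ f f_lin).
exists (lker (linfun f')).
  have := limg_ker_dim (linfun f') fullv.
  rewrite capfv => e; have -> : (n * n = \dim {:'M[F]_n})%N by rewrite dimvf dim_matrix.
  rewrite -e; congr (_ + _)%N.
  (* Rank-nullity applies once the map is onto; preimages come from a left inverse of the transposed
     family. *)
  suff -> : limg (linfun f') = fullv.
    by rewrite dimvf dim_matrix; exact/esym/mul1n.
  apply/vspaceP => u; rewrite memvf; apply/memv_imgP.
  have /row_fullP[B eB] : row_full (family_mx X)^T.
    by rewrite /row_full mxrank_tr; exact: frX.
  exists (vec_mx (u *m B))^T; first exact: memvf.
  rewrite lfunE /=; apply/rowP => i.
  rewrite [RHS]mxE mxtrace_mxvec trmxK vec_mxK -[in LHS](mulmx1 u) -eB mulmxA.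
  rewrite [LHS]mxE [RHS]mxE; apply: eq_bigr => k _.
  by rewrite mulrC [in LHS]mxE [in LHS]mxE [in RHS]mxE.
move=> D; rewrite memv_ker lfunE /=; split.
  move/eqP/rowP => f0 i; have := f0 (enum_rank i).
  by rewrite !mxE enum_rankK.
by move=> D0; apply/eqP/rowP => i; rewrite !mxE D0.
Qed.

End FreeFamilies.

(** * Eigenbases of skew-symmetric matrices *)

Lemma trmxX (A : comPzRingType) n (X : 'M[A]_n) k : (X ^+ k)^T = X^T ^+ k.
Proof. by elim: k => [|k IH]; rewrite ?trmx1 // exprS trmx_mul IH [RHS]exprSr. Qed.

Lemma mxtrace_odd_skew (F : numFieldType) n (B N : 'M[F]_n) l :
  B^T = B -> N^T = - N -> odd l -> \tr (B *m N ^+ l) = 0.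
Proof.
move=> eB eN ol.
have e : \tr (B *m N ^+ l) = - \tr (B *m N ^+ l).
  rewrite -{1}mxtrace_tr trmx_mul eB trmxX eN exprNn -signr_odd ol expr1.
  by rewrite mulN1r mulNmx linearN /= mxtrace_mulC.
by apply/eqP; rewrite -eqNr -e.
Qed.

(** Induction on the size: a pair [x], [- x] with [x != 0] is removed and put back at the two ends.
    What remains in the middle is at most a single 0. *)
Lemma opp_symmetric_order (F : numFieldType) (s : seq F) :
  uniq s -> (forall x, x \in s -> - x \in s) ->
  exists2 s', perm_eq s s' & map -%R s' = rev s'.
Proof.
have [m] := ubnP (size s); elim: m s => // m IH s sz_s us sN.
case: (altP (@hasP _ (fun x => x != 0) s)) => [[x xs x0]|]; last first.
  rewrite -all_predC => /allP s0; exists s => //.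
  have {}s0 x : x \in s -> x = 0 by move/s0/negbNE/eqP.
  case: s us {sz_s sN} s0 => [|a [|b s]] //= us s0.
    by rewrite (s0 a) ?oppr0 // mem_head.
  move: us; rewrite (s0 a) ?mem_head // in_cons (s0 b) ?eqxx //.
  by rewrite !in_cons eqxx orbT.
have xN : x != - x.
  by rewrite eq_sym eqNr.
pose t := [seq y <- s | (y != x) && (y != - x)].
have [|||t' tt' et'] := IH t.
- rewrite size_filter -ltnS (leq_trans _ sz_s) // ltnS.
  rewrite -(count_predC (fun y => (y != x) && (y != - x)) s) -addn1 leq_add2l.
  by rewrite -has_count; apply/hasP; exists x => //=; rewrite eqxx.
- exact: filter_uniq.
- move=> y; rewrite !mem_filter -andbA => /and3P[y1 y2 ys].
  by rewrite eqr_opp eqr_oppLR y1 y2 sN.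
exists (x :: rcons t' (- x)); last first.
  by rewrite /= map_rcons et' opprK rev_cons rev_rcons.
have ut' : uniq t' by rewrite -(perm_uniq tt') filter_uniq.
have mt' y : (y \in t') = (y != x) && (y != - x) && (y \in s).
  by rewrite -(perm_mem tt') mem_filter.
apply: uniq_perm => //.
  rewrite /= mem_rcons rcons_uniq in_cons !mt' !eqxx /= andbF /=.
  by rewrite orbF xN ut'.
move=> y; rewrite in_cons mem_rcons in_cons mt'.
case: eqP => [->|_] //=; case: eqP => [->|_] //=.
exact: sN.
Qed.

Section Eigenbasis.
Variable F : fieldType.
Variable n : nat.
Implicit Types (N P : 'M[F]_n) (lam : 'rV[F]_n).

Lemma Vandermonde_unit lam : injective (lam 0) -> Vandermonde n lam \in unitmx.
Proof.
move=> inj; rewrite unitmxE det_Vandermonde unitfE.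
apply/prodf_neq0 => i _; apply/prodf_neq0 => j ij; rewrite subr_eq0.
by apply: contraTneq ij => /inj ->; rewrite ltnn.
Qed.

Lemma Vandermonde_coef lam (c : 'I_n -> F) : injective (lam 0) ->
  (forall p, \sum_l c l * lam 0 p ^+ l = 0) -> forall l, c l = 0.
Proof.
move=> /Vandermonde_unit uV c0 l.
suff /rowP/(_ l): \row_l c l = 0 by rewrite !mxE.
rewrite -[LHS](mulmxK uV) (_ : _ *m Vandermonde n lam = 0) ?mul0mx //.
by apply/rowP => p; rewrite !mxE -[RHS](c0 p); apply: eq_bigr => k _; rewrite !mxE.
Qed.

Lemma Vandermonde_point lam (d : 'I_n -> F) : injective (lam 0) ->
  (forall l : 'I_n, \sum_p d p * lam 0 p ^+ l = 0) -> forall p, d p = 0.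
Proof.
move=> /Vandermonde_unit uV d0 p.
suff /colP/(_ p): \col_p d p = 0 by rewrite !mxE.
rewrite -[LHS](mulKmx uV) (_ : Vandermonde n lam *m _ = 0) ?mulmx0 //.
apply/colP => l; rewrite !mxE -[RHS](d0 l); apply: eq_bigr => k _.
by rewrite !mxE mulrC.
Qed.

Lemma diag_mxX lam k : diag_mx lam ^+ k = diag_mx (\row_p lam 0 p ^+ k).
Proof.
elim: k => [|k IH].
  by apply/matrixP => i j; rewrite expr0 !mxE.
rewrite exprS IH mulr_mx mulmx_diag; congr diag_mx.
by apply/rowP => p; rewrite !mxE exprS.
Qed.

Lemma intertwineX P N lam k :
  P *m N = diag_mx lam *m P -> P *m N ^+ k = diag_mx lam ^+ k *m P.
Proof.
move=> e; elim: k => [|k IH]; first by rewrite !expr0 mul1mx mulmx1.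
by rewrite !exprSr !mulr_mx mulmxA IH -mulmxA e mulmxA.
Qed.

Lemma row_diag_mul u P p : row p (diag_mx u *m P) = u 0 p *: row p P.
Proof. by apply/rowP => j; rewrite mul_diag_mx !mxE. Qed.

(** If [u *m P = 0], applying the powers of [N] gives a Vandermonde system that kills each
    [u 0 p *: row p P] separately. *)
Lemma eigenvectors_unit N P lam :
  P *m N = diag_mx lam *m P -> injective (lam 0) -> (forall p, row p P != 0) ->
  P \in unitmx.
Proof.
move=> ePN inj P0; rewrite -row_free_unit -kermx_eq0.
apply/rowV0P => u /sub_kermxP u0.
have uP : diag_mx u *m P = 0.
  rewrite -[LHS](mulKmx (Vandermonde_unit inj)).
  rewrite (_ : Vandermonde n lam *m _ = 0) ?mulmx0 //.
  apply/row_matrixP => k; rewrite row0 row_mul.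
  transitivity (u *m (P *m N ^+ k)); last by rewrite mulmxA u0 mul0mx.
  rewrite (intertwineX k ePN) diag_mxX !mulmxA -row_mul row_mul; congr (_ *m _).
  by apply/rowP => p; rewrite !mul_mx_diag !mxE mulrC.
apply/rowP => p; rewrite [RHS]mxE; apply/eqP.
have /eqP := congr1 (row p) uP.
rewrite row_diag_mul row0 scalemx_eq0 => /orP[//|].
by rewrite (negPf (P0 p)).
Qed.

(** [N] and its transpose [- N] have the same characteristic polynomial. *)
Lemma skew_eigenvalueN N a : N^T = - N -> eigenvalue N a -> eigenvalue N (- a).
Proof.
move=> eN; rewrite !eigenvalue_root_char.
have e : char_poly N = char_poly N^T.
  rewrite /char_poly -det_tr; congr (\det _); apply/matrixP => i j.
  by rewrite !mxE eq_sym.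
rewrite {1}e eN -!eigenvalue_root_char => /eigenvalueP[v ev v0].
by apply/eigenvalueP; exists v; rewrite // scaleNr -ev mulmxN opprK.
Qed.

(** In the eigenbasis, [diag lam, b] multiplies the entry (p, q) by lam_p - lam_q, so the only
    obstruction is the diagonal of [B]; the trace conditions say that it is orthogonal to all powers
    of lam. *)
Lemma diag_commutator N P lam (B : 'M[F]_n) :
  P \in unitmx -> P *m N = diag_mx lam *m P -> injective (lam 0) ->
  (forall l, (l < n)%N -> \tr (B *m N ^+ l) = 0) ->
  exists b, N *m b - b *m N = B.
Proof.
move=> uP ePN inj trB.
pose B' := P *m B *m invmx P.
have B'0 p : B' p p = 0.
  apply: (Vandermonde_point inj (d := fun p => B' p p)) => l.
  rewrite -[RHS](trB l) //; transitivity (\tr (B' *m diag_mx lam ^+ l)).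
    rewrite diag_mxX mul_mx_diag; apply: eq_bigr => q _; by rewrite !mxE.
  rewrite /B' -[N ^+ l](mulKmx uP) (intertwineX l ePN) -!mulmxA mxtrace_mulC.
  by rewrite !mulmxA.
(* The quotient is only a default value on the diagonal, where [Z] vanishes. *)
have [b' eb'] : exists b', diag_mx lam *m b' - b' *m diag_mx lam = B'.
  move: B' B'0 => Z Z0; exists (\matrix_(p, q) (Z p q / (lam 0 p - lam 0 q))).
  apply/matrixP => p q; rewrite mul_diag_mx mul_mx_diag !mxE.
  have [->|npq] := eqVneq p q; first by rewrite Z0 mul0r mulr0 mul0r subrr.
  rewrite [X in _ - X]mulrC -mulrBl mulrCA mulfV ?mulr1 // subr_eq0.
  by apply: contra_neq npq => /inj.
have eN : N = invmx P *m diag_mx lam *m P by rewrite -mulmxA -ePN mulKmx.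
exists (invmx P *m b' *m P); rewrite eN.
rewrite -!mulmxA !(mulKVmx uP) !mulmxA.
rewrite -mulmxBl -!mulmxA -mulmxBr eb' /B' !mulmxA mulVmx // mul1mx.
by rewrite mulmxKV.
Qed.

End Eigenbasis.

Lemma skew_eigenbasis (F : numClosedFieldType) n (N : 'M[F]_n) :
  N^T = - N -> separable_poly (char_poly N) ->
  exists (P : 'M[F]_n) (lam : 'rV[F]_n),
    [/\ P \in unitmx, P *m N = diag_mx lam *m P, injective (lam 0)
                  & forall p, lam 0 (rev_ord p) = - lam 0 p].
Proof.
move=> eN; have [s es] := closed_field_poly_normal (char_poly N).
rewrite (monicP (char_poly_monic N)) scale1r in es.
rewrite es separable_prod_XsubC => us.
have ms x : (x \in s) = eigenvalue N x.
  by rewrite eigenvalue_root_char es root_prod_XsubC.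
have [x|s' ss' es'] := opp_symmetric_order us.
  by rewrite !ms; exact: skew_eigenvalueN.
have sz : size s' = n.
  have := size_char_poly N; rewrite es size_prod_XsubC => -[<-].
  by rewrite (perm_size ss').
pose lam : 'rV[F]_n := \row_p s'`_p.
have [v ev v0] : exists2 v : 'I_n -> 'rV[F]_n,
    forall p, v p *m N = lam 0 p *: v p & forall p, v p != 0.
  apply: (@fin_all_exists2 _ _ (fun p w => w *m N = lam 0 p *: w)
            (fun p w => w != 0)) => p.
  apply/eigenvalueP; rewrite -ms (perm_mem ss') mxE mem_nth // sz.
  exact: ltn_ord.
have ePN : (\matrix_p v p) *m N = diag_mx lam *m \matrix_p v p.
  apply/row_matrixP => p; rewrite row_mul rowK ev row_diag_mul rowK //.
have inj : injective (lam 0).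
  move=> p q; rewrite !mxE => /eqP.
  by rewrite nth_uniq ?sz ?ltn_ord // -?(perm_uniq ss') // => /eqP/val_inj.
exists (\matrix_p v p), lam; split=> //.
  by apply: (eigenvectors_unit ePN inj) => p; rewrite rowK.
move=> p; have lt_p : (p < size s')%N by rewrite sz.
by rewrite !mxE /= -(nth_map 0 0) // es' nth_rev // sz.
Qed.


(** * Weighted shifts and the grading by superdiagonals *)

Section ShiftIndependence.
Variable F : fieldType.
Variable m : nat.
Local Notation n := m.+1.
Implicit Types (A B Z : 'M[F]_n) (lam b : 'rV[F]_n) (c : nat -> F).

Definition on_superdiag i A :=
  forall p q : 'I_n, q != (p + i)%N :> nat -> A p q = 0.

Definition weighted_shift b : 'M[F]_n :=
  \matrix_(p, q) (if q == p.+1 :> nat then b 0 p else 0).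

Lemma on_superdiag0 i : on_superdiag i 0.
Proof. by move=> p q _; rewrite mxE. Qed.

Lemma on_superdiagD i A B :
  on_superdiag i A -> on_superdiag i B -> on_superdiag i (A + B).
Proof. by move=> hA hB p q pq; rewrite mxE hA ?hB // addr0. Qed.

Lemma on_superdiagZ i a A : on_superdiag i A -> on_superdiag i (a *: A).
Proof. by move=> hA p q pq; rewrite mxE hA ?mulr0. Qed.

Lemma on_superdiag_sum i (I : finType) (X : I -> 'M[F]_n) :
  (forall x, on_superdiag i (X x)) -> on_superdiag i (\sum_x X x).
Proof.
move=> hX; apply: (big_ind (on_superdiag i)) => //.
- exact: on_superdiag0.
- exact: on_superdiagD.
Qed.

Lemma on_superdiagM i j A B :
  on_superdiag i A -> on_superdiag j B -> on_superdiag (i + j) (A *m B).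
Proof.
move=> hA hB p q pq; rewrite mxE big1 // => k _.
have [ek|nk] := eqVneq (k : nat) (p + i)%N; last by rewrite hA ?mul0r.
by rewrite hB ?mulr0 // ek -addnA.
Qed.

Lemma on_superdiag_psym b lam k l : (l <= k)%N ->
  on_superdiag (k - l) (psym (weighted_shift b) (diag_mx lam) k l).
Proof.
have hJ : on_superdiag 1 (weighted_shift b).
  by move=> p q; rewrite addn1 mxE => /negPf ->.
have hD : on_superdiag 0 (diag_mx lam).
  move=> p q; rewrite addn0 mxE => pq; case: eqP => [e|]; last by rewrite mulr0n.
  by rewrite e eqxx in pq.
elim: k l => [|k IH] [|l] //= le_lk.
- by move=> p q; rewrite addn0 mxE => pq; rewrite eq_sym -val_eqE /= (negPf pq).
- rewrite addr0 subn0 -add1n; apply: on_superdiagM => //.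
  by have := IH 0%N isT; rewrite subn0.
rewrite subSS; apply: on_superdiagD; last first.
  by rewrite -[(k - l)%N]add0n; apply: on_superdiagM => //; exact: IH.
case: (leqP l.+1 k) => [lt_lk|lt_kl].
  by rewrite -subnSK // -add1n; apply: on_superdiagM => //; exact: IH.
by rewrite psym_small // mulr0; exact: on_superdiag0.
Qed.

(** Row p of [weighted_shift b *m Z] is b_p times row p+1 of [Z], so commutation propagates the
    vanishing from each row to the next. *)
Lemma shift_commutant0 b Z : (forall p, b 0 p != 0) ->
  weighted_shift b *m Z = Z *m weighted_shift b -> row 0 Z = 0 -> Z = 0.
Proof.
move=> b0 comJZ Z0; apply/row_matrixP => p; rewrite row0.
case: p; elim=> [|p IH] lt_p; first by rewrite -[RHS]Z0; congr (row _ _); exact: val_inj.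
have lt_p' : (p < n)%N by exact: ltnW.
pose p0 := Ordinal lt_p'.
have := congr1 (row p0) comJZ.
rewrite [RHS]row_mul IH mul0mx => /rowP e; apply/rowP => q.
have := e q; rewrite !mxE (bigD1 (Ordinal lt_p)) //= mxE eqxx big1 ?addr0.
  by move/eqP; rewrite mulf_eq0 (negPf (b0 p0)) => /eqP.
move=> k nk; rewrite mxE; case: eqP => [ek|]; last by rewrite mul0r.
by case/eqP: nk; exact: val_inj.
Qed.

(** The entry is the product of the first [i] weights. *)
Lemma weighted_shift_row0 b i (lt_i : (i < n)%N) : (forall p, b 0 p != 0) ->
  (weighted_shift b ^+ i) 0 (Ordinal lt_i) != 0.
Proof.
move=> b0; elim: i lt_i => [|i IH] lt_i.
  by rewrite expr0 mxE -val_eqE /= oner_eq0.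
have lt_i' : (i < n)%N by exact: ltnW.
rewrite exprSr mxE (bigD1 (Ordinal lt_i')) //= big1 ?addr0.
  by rewrite mulf_neq0 // mxE eqxx.
move=> k nk; rewrite [X in _ * X]mxE /=; case: eqP => [[ek]|]; last by rewrite mulr0.
by case/eqP: nk; exact: val_inj.
Qed.

(* Passing from the i.+1-st to the i-th superdiagonal by psym_comm. *)
Lemma shift_psym_indep b lam i c :
  (forall p, b 0 p != 0) -> injective (lam 0) ->
  (forall l, (n <= i + l)%N -> c l = 0) ->
  \sum_(l < n) c l *: psym (weighted_shift b) (diag_mx lam) (i + l) l = 0 ->
  forall l, c l = 0.
Proof.
move=> b0 inj; set J := weighted_shift b; set D := diag_mx lam.
elim: i c => [|i IH] c cn c0 l.
  (* On the main diagonal the words are the powers of [D], and the relation is a Vandermonde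
     system. *)
  have [lt_l|/cn//] := ltnP l n.
  apply: (Vandermonde_coef (c := fun l : 'I_n => c l) inj _ (Ordinal lt_l)) => p.
  have /matrixP/(_ p p) := c0; rewrite mxE summxE => e; rewrite -[RHS]e.
  apply: eq_bigr => k _; rewrite add0n psym_diag diag_mxX !mxE eqxx mulr1n //.
have [lt_in|le_ni] := ltnP i n; last first.
  by apply: cn; rewrite addSn ltnW // ltnS (leq_trans le_ni) ?leq_addr.
(* [Q] is the given sum with both indices of [psym] moved so that [psym_comm] expresses its
   commutator with [J] through that of the zero sum with [D]. The range stops at [m] because
   [c m = 0]. *)
pose Q := \sum_(l < m) c l *: psym J D (i + l.+1) l.+1.
have Qcomm : J *m Q = Q *m J.
  apply/eqP; rewrite eq_sym -subr_eq0 /Q mulmx_sumr mulmx_suml -sumrB.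
  apply/eqP; transitivity (\sum_(l < m)
    - (c l *: (psym J D (i.+1 + l) l *m D - D *m psym J D (i.+1 + l) l))).
    apply: eq_bigr => k _; rewrite -scalemxAr -scalemxAl -scalerBr -scalerN.
    by rewrite addnS -addSn (psym_comm J D (i.+1 + k) k).
  have e : \sum_(l < m) c l *: psym J D (i.+1 + l) l = 0.
    by rewrite -[RHS]c0 big_ord_recr /= (cn m) ?scale0r ?addr0 // addSn ltnS leq_addl.
  rewrite sumrN; apply/eqP; rewrite oppr_eq0; apply/eqP.
  rewrite (eq_bigr _ (fun k _ => scalerBr _ _ _)) sumrB.
  rewrite (eq_bigr _ (fun k _ => scalemxAl _ _ _)) -mulmx_suml e mul0mx.
  by rewrite (eq_bigr _ (fun k _ => scalemxAr _ _ _)) -mulmx_sumr e mulmx0 subrr.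
have hQ : on_superdiag i Q.
  apply: on_superdiag_sum => k; apply: on_superdiagZ.
  by rewrite -{1}(addnK k.+1 i); apply: on_superdiag_psym; exact: leq_addl.
(* [a] is chosen so that [Q - a *: J ^+ i], which lies on superdiagonal [i], has zero first row;
   since it commutes with [J], it vanishes. *)
pose a := Q 0 (Ordinal lt_in) / (J ^+ i) 0 (Ordinal lt_in).
have hJi : on_superdiag i (J ^+ i).
  by have := on_superdiag_psym b lam (leq0n i); rewrite subn0 psym0.
have Qa : Q - a *: J ^+ i = 0.
  apply: (@shift_commutant0 b) => //.
    rewrite mulmxBr mulmxBl Qcomm -scalemxAr -scalemxAl; congr (_ - _ *: _).
    by have := exprSr J i; rewrite exprS.
  apply/rowP => q; rewrite [LHS]mxE [RHS]mxE.
  have [eq|nq] := eqVneq (q : nat) i; last first.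
    by rewrite mxE [X in _ + X]mxE [X in - X]mxE hQ // hJi // mulr0 subrr.
  have -> : q = Ordinal lt_in by exact: val_inj.
  by rewrite mxE [X in _ + X]mxE [X in - X]mxE /a divfK ?subrr // weighted_shift_row0.
(* Since [J ^+ i] is [psym J D i 0], the equation [Q = a *: J ^+ i] is a relation on superdiagonal
   [i], with the old coefficients moved up by one. *)
pose d k := if k is k'.+1 then c k' else - a.
apply: (IH d _ _ l.+1).
  case=> [|k] /=; rewrite ?addn0; first by rewrite leqNgt lt_in.
  by rewrite addnS -addSn; exact: cn.
rewrite big_ord_recl /= addn0 psym0 -[RHS]Qa scaleNr addrC; congr (_ - _).
Qed.

End ShiftIndependence.

(** * Freeness of the gradients in a suitable direction *)

Definition psym_idx n (x : 'I_n * 'I_n) := (x.2 <= x.1)%N && ~~ odd x.2.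

Definition psym_family (F : pzRingType) n (S N : 'M[F]_n)
    (x : {x : 'I_n * 'I_n | psym_idx x}) : 'M[F]_n :=
  psym S N (val x).1 (val x).2.

Lemma psym_freeP (F : fieldType) n (S N : 'M[F]_n) :
  mxfree (psym_family S N) <->
  forall c : 'I_n * 'I_n -> F,
    \sum_(x | psym_idx x) c x *: psym S N x.1 x.2 = 0 ->
    forall x, psym_idx x -> c x = 0.
Proof.
rewrite mxfreeP; split=> H c c0.
  move=> x idx_x; apply: (H (fun y => c (val y)) _ (Sub x idx_x)).
  by rewrite -[RHS]c0; symmetry; exact: big_sub.
pose c' (x : 'I_n * 'I_n) := if insub x is Some y then c y else 0.
have c'E y : c' (val y) = c y by rewrite /c' valK.
move=> y; rewrite -c'E; apply: H (valP y).
rewrite -[RHS]c0 (eq_bigr (fun y => c' (val y) *: psym S N (val y).1 (val y).2)).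
  exact: big_sub.
by move=> z _; rewrite c'E.
Qed.

(** Different superdiagonals cannot cancel, so a relation splits into relations with [k - l] fixed,
    which [shift_psym_indep] excludes. *)
Lemma shift_psym_free (F : fieldType) m (b lam : 'rV[F]_m.+1) :
  (forall p, b 0 p != 0) -> injective (lam 0) ->
  mxfree (psym_family (weighted_shift b) (diag_mx lam)).
Proof.
move=> b0 inj; apply/psym_freeP => c c0 [k0 l0] /andP[/= le_lk0 ev_l0].
set J := weighted_shift b in c0; set D := diag_mx lam in c0.
pose i := (k0 - l0)%N.
pose Q (x : 'I_m.+1 * 'I_m.+1) := psym_idx x && ((x.1 - x.2)%N == i).
(* At most one pair contributes, since [k = i + l]; [d l] is 0 when that pair is not an admissible
   index. *)
pose d (l : nat) := \sum_(x : 'I_m.+1 * 'I_m.+1 | Q x && (x.2 == l :> nat)) c x.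
have QP x : Q x -> (i + x.2)%N = x.1.
  by move=> /andP[/andP[le_x _] /eqP <-]; rewrite subnK.
have d0 : forall l, d l = 0.
  apply: (shift_psym_indep (i := i) b0 inj) => [l le_nl|].
    rewrite /d big_pred0 // => x; apply/negP => /andP[/QP e /eqP el].
    by have := ltn_ord x.1; rewrite -e el ltnNge le_nl.
  transitivity (\sum_(x | Q x) c x *: psym J D x.1 x.2).
    rewrite (partition_big (fun x => x.2) predT) //=; apply: eq_bigr => l _.
    rewrite scaler_suml; apply: eq_bigr => x /andP[/QP e /eqP el].
    by rewrite -e el.
  apply/matrixP => p q; rewrite [RHS]mxE summxE.
  have grade x : psym_idx x -> q != (p + (x.1 - x.2))%N :> nat ->
      (c x *: psym J D x.1 x.2) p q = 0.
    move=> /andP[le_x _] pq; rewrite mxE (on_superdiag_psym b lam le_x) //.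
    by rewrite mulr0.
  have [eq|nq] := eqVneq (q : nat) (p + i)%N; last first.
    by apply: big1 => x /andP[ix /eqP ei]; rewrite grade // ei.
  have := congr1 (fun Z : 'M_m.+1 => Z p q) c0.
  rewrite [RHS]mxE summxE (bigID (fun x : 'I_m.+1 * 'I_m.+1 => (x.1 - x.2)%N == i)) /=.
  rewrite [X in _ + X]big1 ?addr0 // => x /andP[ix ni].
  by rewrite grade // eq eqn_add2l eq_sym.
have := d0 l0; rewrite /d (big_pred1 (k0, l0)) // => -[k l] /=.
rewrite xpair_eqE -(val_eqE l) /=; have [el|_] := eqVneq (l : nat) l0; last first.
  by rewrite !andbF.
rewrite !andbT /Q /psym_idx /= el ev_l0 andbT -val_eqE /= /i.
apply/andP/eqP => [[le_lk /eqP e]|->]; last by rewrite le_lk0 eqxx.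
by rewrite -(subnK le_lk) e subnK.
Qed.

Lemma psym_free_conj (F : fieldType) n (P S N : 'M[F]_n) : P \in unitmx ->
  mxfree (psym_family S N) ->
  mxfree (psym_family (invmx P *m S *m P) (invmx P *m N *m P)).
Proof.
move=> uP /psym_freeP H; apply/psym_freeP => c c0; apply: H.
set Z := \sum_(x | _) _; suff: invmx P *m Z *m P = 0.
  by move=> e; rewrite -[Z](mulKVmx uP) -[_ *m Z](mulmxK uP) e mul0mx mulmx0.
rewrite -[RHS]c0 /Z mulmx_sumr mulmx_suml; apply: eq_bigr => x _.
by rewrite psym_conj // -scalemxAr -scalemxAl.
Qed.

(* The eigenvectors p and rev p of the skew matrix N pair to a nonzero b_p; a
   shift weighted by b is then symmetric for the transported bilinear form. *)
Lemma skew_psym_free (F : numClosedFieldType) n (N : 'M[F]_n) :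
  N^T = - N -> separable_poly (char_poly N) ->
  exists D : 'M[F]_n, [/\ D^T = D, forall l, \tr (D *m N ^+ l) = 0
                        & mxfree (psym_family D N)].
Proof.
case: n N => [|m] N eN sepN.
  exists 0; split; first by rewrite trmx0.
    by move=> l; rewrite mul0mx mxtrace0.
  by apply/psym_freeP => c _ [[]].
have [P [lam [uP ePN inj lam_rev]]] := skew_eigenbasis eN sepN.
(* The Gram matrix of the eigenvectors. As [N] is skew, eigenvectors are orthogonal unless their
   eigenvalues add up to 0, so [B] lives on the antidiagonal. *)
pose B := P *m P^T.
have symB : B^T = B by rewrite /B trmx_mul trmxK.
have B0 p q : q != rev_ord p -> B p q = 0.
  move=> nq; have e : diag_mx lam *m B = - (B *m diag_mx lam).
    rewrite /B mulmxA -ePN -!mulmxA -mulmxN; congr (_ *m _).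
    rewrite -[N]trmxK -[diag_mx lam]trmxK -!trmx_mul tr_diag_mx eN -ePN.
    by rewrite mulmxN linearN.
  have /eqP := congr1 (fun Z : 'M_m.+1 => Z p q) e.
  rewrite mul_diag_mx mul_mx_diag !mxE.
  rewrite -addr_eq0 mulrC -mulrDr mulf_eq0 addr_eq0 -lam_rev.
  by case/orP => [/eqP//|/eqP/inj ep]; rewrite ep rev_ordK eqxx in nq.
pose b := \row_p B p (rev_ord p).
have b0 p : b 0 p != 0.
  apply/eqP => bp0; have uB : B \in unitmx by rewrite unitmx_mul unitmx_tr uP.
  have /rowP/(_ p) : row p (B *m invmx B) = 0.
    apply/rowP => j; rewrite row_mul [RHS]mxE mxE big1 // => k _.
    rewrite mxE; have [->|nk] := eqVneq k (rev_ord p).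
      by move: bp0; rewrite mxE => ->; rewrite mul0r.
    by rewrite B0 // mul0r.
  by rewrite mulmxV // !mxE eqxx => /eqP; rewrite oner_eq0.
pose J := weighted_shift b.
(* Symmetry of [J] for the form [B]: the entry (p, q) of [J *m B] is b_p b_q if [rev_ord q] is p+1
   and 0 otherwise, and that condition is symmetric in p and q. *)
have JB : J *m B = B *m J^T.
  have eBJ : B *m J^T = (J *m B)^T by rewrite trmx_mul symB.
  have JBE p q : (J *m B) p q = if rev_ord q == p.+1 :> nat then b 0 p * b 0 q else 0.
    rewrite mxE (bigD1 (rev_ord q)) //= big1 ?addr0; last first.
      move=> k nk; rewrite B0 ?mulr0 //; apply: contra_neq nk => ->.
      by rewrite rev_ordK.
    rewrite [J _ _]mxE /=; case: eqP => _; last by rewrite mul0r.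
    by congr (_ * _); rewrite [RHS]mxE -[in LHS]symB [LHS]mxE.
  rewrite eBJ; apply/matrixP => p q; rewrite [RHS]mxE !JBE [b 0 p * _]mulrC.
  congr (if _ then _ else _); rewrite /= !subSS.
  by apply/eqP/eqP => e; have := ltn_ord p; have := ltn_ord q; lia.
have eN' : N = invmx P *m diag_mx lam *m P by rewrite -mulmxA -ePN mulKmx.
exists (invmx P *m J *m P); split.
- have uPT : P^T \in unitmx by rewrite unitmx_tr.
  apply: (can_inj (mulKmx uP)); apply: (can_inj (mulmxK uPT)).
  rewrite !trmx_mul trmx_inv !mulmxA mulmxKV // mulmxV // mul1mx.
  by rewrite -/B -JB /B mulmxA.
(* A shift has zero diagonal, hence zero trace against every diagonal matrix. *)
- move=> l; rewrite -[N ^+ l](mulKmx uP) (intertwineX l ePN) diag_mxX.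
  rewrite -!mulmxA mxtrace_mulC -!mulmxA mulmxV // mulmx1 mulKVmx //.
  rewrite mul_mx_diag; apply: big1 => p _.
  by rewrite !mxE -[_ == _]negbK neq_ltn leqnn /= mul0r.
rewrite [X in psym_family _ X]eN'; apply: psym_free_conj => //.
exact: shift_psym_free.
Qed.

Lemma poly_nonroot_nat (F : numFieldType) (q : {poly F}) (M : nat) :
  q != 0 -> exists2 k : nat, (M <= k)%N & ~~ root q k%:R.
Proof.
move=> q0; apply: contrapT => H.
have rootq k : (M <= k)%N -> root q k%:R.
  by move=> le_Mk; apply/negPn/negP => nr; apply: H; exists k.
have := @max_poly_roots _ q [seq k%:R | k <- iota M (size q)] q0.
rewrite size_map size_iota ltnn => H'; apply: (notF (H' _ _)).
  by apply/allP => _ /mapP[k + ->]; rewrite mem_iota => /andP[+ _]; exact: rootq.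
by rewrite map_inj_uniq ?iota_uniq //; exact: mulrIn (oner_neq0 _).
Qed.

(** The line is treated as one family over the polynomial ring, specialised at each [t]. *)
Lemma psym_free_line (F : fieldType) n (A D N : 'M[F]_n) (t0 : F) :
  mxfree (psym_family (A + t0 *: D) N) ->
  exists2 q : {poly F}, q != 0 &
    forall t, ~~ root q t -> mxfree (psym_family (A + t *: D) N).
Proof.
pose X := psym_family (map_mx polyC A + 'X *: map_mx polyC D) (map_mx polyC N).
have polyCK t (Z : 'M[F]_n) : map_mx (horner_eval t) (map_mx polyC Z) = Z.
  by apply/matrixP => i j; rewrite !mxE /horner_eval hornerC.
have XE t : (fun x => map_mx (horner_eval t) (X x)) = psym_family (A + t *: D) N.
  apply/funext => x; rewrite /X /psym_family psym_map map_mxD map_mxZ /=.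
  by rewrite !polyCK /horner_eval hornerX.
by rewrite -XE => /mxfree_horner[q q0 H]; exists q => // t /H; rewrite XE.
Qed.

Lemma psym_free_scale (F : fieldType) n (a : F) (S N : 'M[F]_n) : a != 0 ->
  mxfree (psym_family S N) -> mxfree (psym_family (a *: S) N).
Proof.
move=> a0 /psym_freeP H; apply/psym_freeP => c c0 x idx_x.
have := H (fun x => c x * a ^+ (x.1 - x.2)) _ x idx_x.
move=> /(_ _)/eqP; rewrite mulf_eq0 expf_eq0 (negPf a0) andbF orbF.
move=> e; apply/eqP/e; rewrite -[RHS]c0; apply: eq_bigr => y _.
by rewrite psym_scale scalerA.
Qed.

(** * Descent from complex to real matrices *)

Section RealDirection.
Variable R : rcfType.
Local Notation C := R[i].
Local Notation toC := (map_mx (real_complex R)).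

Local Notation ReM := (map_mx (@complex.Re R)).

Lemma complex_ReD : {morph (@complex.Re R) : x y / x + y}.
Proof. by move=> [a b] [c d]. Qed.

Lemma complex_Re_sum (I : Type) (r : seq I) (P : pred I) (f : I -> C) :
  complex.Re (\sum_(i <- r | P i) f i) = \sum_(i <- r | P i) complex.Re (f i).
Proof. exact: (big_morph _ complex_ReD). Qed.

Lemma map_Re_mull m n p (A : 'M[R]_(m, n)) (Z : 'M[C]_(n, p)) :
  ReM (toC A *m Z) = A *m ReM Z.
Proof.
apply/matrixP => i j; rewrite !mxE complex_Re_sum; apply: eq_bigr => k _.
by rewrite !mxE; case: (Z k j) => a b /=; rewrite mul0r subr0.
Qed.

Lemma map_Re_mulr m n p (A : 'M[R]_(n, p)) (Z : 'M[C]_(m, n)) :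
  ReM (Z *m toC A) = ReM Z *m A.
Proof.
apply/matrixP => i j; rewrite !mxE complex_Re_sum; apply: eq_bigr => k _.
by rewrite !mxE; case: (Z i k) => a b /=; rewrite mulr0 subr0.
Qed.

Lemma map_Re_sub m n (Z W : 'M[C]_(m, n)) : ReM (Z - W) = ReM Z - ReM W.
Proof.
by apply/matrixP => i j; rewrite !mxE; case: (Z i j) (W i j) => a b [c d].
Qed.

Lemma map_ReK m n (A : 'M[R]_(m, n)) : ReM (toC A) = A.
Proof. by apply/matrixP => i j; rewrite !mxE. Qed.

Lemma map_mxX_toC n (A : 'M[R]_n) k : toC (A ^+ k) = toC A ^+ k.
Proof.
elim: k => [|k IH]; first by rewrite !expr0 map_mx1.
by rewrite !exprS map_mxM IH.
Qed.

(** Solve over the complex numbers and take the real part. As [N] is skew and [B] symmetric, the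
    transpose of a solution is again one, and the mean of the two is symmetric. *)
Lemma skew_commutator_solve n (N B : 'M[R]_n) :
  N^T = - N -> separable_poly (char_poly N) -> B^T = B ->
  (forall l, ~~ odd l -> (l < n)%N -> \tr (B *m N ^+ l) = 0) ->
  exists2 b, b^T = b & N *m b - b *m N = B.
Proof.
move=> eN sepN eB trB.
have eNC : (toC N)^T = - toC N by rewrite map_trmx eN map_mxN.
have sepNC : separable_poly (char_poly (toC N)).
  by rewrite -map_char_poly separable_map.
have [P [lam [uP ePN inj _]]] := skew_eigenbasis eNC sepNC.
have [l lt_ln|b eb] := diag_commutator (B := toC B) uP ePN inj.
  rewrite -map_mxX_toC -map_mxM trace_map_mx -[RHS](rmorph0 (real_complex R)).
  congr (_ _); have [ol|el] := boolP (odd l); last by rewrite trB.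
  by rewrite mxtrace_odd_skew.
pose r := ReM b; have er : N *m r - r *m N = B.
  by rewrite -map_Re_mull -map_Re_mulr -map_Re_sub eb map_ReK.
have ert : N *m r^T - r^T *m N = B.
  rewrite -[in RHS]eB -[in RHS]er linearB /= !trmx_mul eN mulmxN mulNmx.
  by rewrite opprK addrC.
exists (2^-1 *: (r + r^T)).
  by rewrite linearZ linearD /= trmxK addrC.
rewrite -scalemxAr -scalemxAl -scalerBr mulmxDr mulmxDl opprD addrACA er ert.
by rewrite -mulr2n -[B *+ 2]scaler_nat scalerA mulVf ?scale1r // pnatr_eq0.
Qed.

(** A complex direction is Re D + i Im D. Freeness on the line Re D + t Im D holds at t = i, hence
    at some natural number t, where the direction is real. *)
Lemma skew_psym_free_real n (N : 'M[R]_n) :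
  N^T = - N -> separable_poly (char_poly N) ->
  exists D : 'M[R]_n, [/\ D^T = D, forall l, \tr (D *m N ^+ l) = 0
                        & mxfree (psym_family D N)].
Proof.
move=> eN sepN.
have eNC : (toC N)^T = - toC N by rewrite map_trmx eN map_mxN.
have sepNC : separable_poly (char_poly (toC N)).
  by rewrite -map_char_poly separable_map.
have [D [symD trD freeD]] := skew_psym_free eNC sepNC.
have Re_sym (Z : 'M[C]_n) : Z^T = Z -> (ReM Z)^T = ReM Z.
  by move=> e; rewrite map_trmx e.
have Re_tr (Z : 'M[C]_n) :
    (forall l, \tr (Z *m toC N ^+ l) = 0) -> forall l, \tr (ReM Z *m N ^+ l) = 0.
  move=> e l; rewrite -map_Re_mulr map_mxX_toC.
  rewrite -[RHS](congr1 (@complex.Re R) (e l)) /mxtrace complex_Re_sum.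
  by apply: eq_bigr => k _; rewrite mxE.
(* Multiplying by -i makes the imaginary part of [D] the real part of [D']. *)
pose D' : 'M[C]_n := (- 'i%C) *: D.
have symD' : D'^T = D' by rewrite linearZ /= symD.
have trD' l : \tr (D' *m toC N ^+ l) = 0.
  by rewrite -scalemxAl linearZ /= trD mulr0.
have eD : D = toC (ReM D) + 'i%C *: toC (ReM D').
  apply/matrixP => i j; rewrite !mxE; case: (D i j) => a b /=.
  by apply/eqP; rewrite eq_complex; apply/andP; split; apply/eqP => /=; lra.
rewrite eD in freeD; have [q q0 freeq] := psym_free_line freeD.
have [k _ /freeq free_k] := poly_nonroot_nat 0 q0.
exists (ReM D + k%:R *: ReM D'); split.
- by rewrite linearD linearZ /= !Re_sym.
- by move=> l; rewrite mulmxDl -scalemxAl linearD linearZ /= !Re_tr // mulr0 addr0.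
rewrite -(mxfree_map (real_complex R)).
rewrite (_ : (fun x => _) = psym_family (toC (ReM D) + k%:R *: toC (ReM D')) (toC N)) //.
apply/funext => x; rewrite /psym_family psym_map map_mxD map_mxZ.
by rewrite (rmorph_nat (real_complex R)).
Qed.

End RealDirection.

(** The line D + t S is free at t = 0, hence at arbitrarily large natural k; rescaling by 1/k turns
    that point into S + D/k, a small perturbation of S. *)
Lemma psym_free_dense (R : realType) n (S N : 'M[R]_n) (eps : R) :
  N^T = - N -> separable_poly (char_poly N) -> 0 < eps ->
  exists D : 'M[R]_n, [/\ D^T = D, forall l, \tr (D *m N ^+ l) = 0,
    mxfree (psym_family (S + D) N) & forall i j, `|D i j| < eps].
Proof.
move=> eN sepN eps0; have [D [symD trD freeD]] := skew_psym_free_real eN sepN.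
have [|q q0 freeq] := @psym_free_line R n D S N 0.
  by rewrite scale0r addr0.
pose T : R := \sum_i \sum_j `|D i j|.
have leT i j : `|D i j| <= T.
  rewrite /T (bigD1 i) //= (bigD1 j) //= -addrA lerDl addr_ge0 ?sumr_ge0 //.
  by move=> k _; rewrite sumr_ge0.
have T0 : 0 <= T / eps.
  apply: divr_ge0; last exact: ltW.
  by apply: sumr_ge0 => i _; apply: sumr_ge0.
have [k le_k /freeq freek] := poly_nonroot_nat (Num.bound (T / eps)).+1 q0.
have k0 : 0 < k%:R :> R by rewrite ltr0n (leq_trans _ le_k).
exists (k%:R^-1 *: D); split.
- by rewrite linearZ /= symD.
- by move=> l; rewrite -scalemxAl linearZ /= trD mulr0.
- rewrite (_ : S + _ = k%:R^-1 *: (D + k%:R *: S)).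
    by apply: psym_free_scale => //; rewrite invr_neq0 // gt_eqF.
  by rewrite scalerDr scalerA mulVf ?scale1r 1?addrC // gt_eqF.
move=> i j; rewrite mxE normrM ger0_norm ?invr_ge0 ?ltW //.
rewrite mulrC ltr_pdivrMr // (le_lt_trans (leT i j)) //.
rewrite mulrC -ltr_pdivrMr // (lt_trans (archi_boundP T0)) // ltr_nat.
exact: leq_trans le_k.
Qed.

(** * The tangent space of the orbit and its annihilator *)

Section SkewTangent.
Variables (R : rcfType) (n : nat) (N : 'M[R]_n).
Hypotheses (skewN : N^T = - N) (sepN : separable_poly (char_poly N)).

Lemma mxtrace_commutatorX (b : 'M[R]_n) l : \tr ((N *m b - b *m N) *m N ^+ l) = 0.
Proof.
rewrite mulmxBl linearB /= -!mulmxA mxtrace_mulC -!mulmxA.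
by rewrite -[N ^+ l *m N]exprSr -[N *m N ^+ l]exprS subrr.
Qed.

Lemma skew_tangentP (D : 'M[R]_n) : D^T = D ->
  (forall l, ~~ odd l -> (l <= n.-1)%N -> \tr (D *m N ^+ l) = 0) ->
  exists2 b, b^T = b & N *m b - b *m N = D.
Proof.
move=> symD trD; apply: skew_commutator_solve => // l el lt_ln.
by apply: trD => //; rewrite -ltnS (ltn_predK lt_ln).
Qed.

(** The even powers of [N] are the diagonal members of a free [psym_family]. *)
Lemma skew_powers_free (c : nat -> R) :
  \sum_(l < n | ~~ odd l) c l *: N ^+ l = 0 ->
  forall l, (l < n)%N -> ~~ odd l -> c l = 0.
Proof.
move=> c0 l lt_ln el; have [D [_ _ /psym_freeP freeD]] := skew_psym_free_real skewN sepN.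
pose x := (Ordinal lt_ln, Ordinal lt_ln).
have := freeD (fun x => if x.1 == x.2 then c x.2 else 0) _ x.
rewrite /= eqxx; apply; last by rewrite /psym_idx /= leqnn el.
rewrite -[RHS]c0 big_mkcond /= -(pair_big_dep predT (fun _ _ => true)
  (fun k l : 'I_n => if psym_idx (k, l) then
     (if k == l then c l else 0) *: psym D N k l else 0)) /=.
rewrite exchange_big [RHS]big_mkcond /=; apply: eq_bigr => k _.
rewrite (bigD1 k) //= big1 ?addr0 => [|j nj]; last first.
  by rewrite (negPf nj) scale0r if_same.
by rewrite eqxx psym_diag /psym_idx /= leqnn.
Qed.

Lemma even_coef_extend (c : {l : 'I_n | ~~ odd l} -> R) :
  exists2 a : nat -> R, forall l, a (val (val l)) = c l &
    \sum_l c l *: N ^+ val l = \sum_(l < n | ~~ odd l) a l *: N ^+ l.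
Proof.
pose a l := if insub l is Some l' then
  (if insub l' is Some l'' then c l'' else 0) else 0.
have aE l : a (val (val l : 'I_n)) = c l by rewrite /a !valK.
exists a => //.
rewrite (eq_bigr (fun l => a (val l : 'I_n) *: N ^+ (val l : 'I_n))) => [|l _].
  symmetry.
  exact: (big_sub [pred l : 'I_n | ~~ odd l] (fun l : 'I_n => a l *: N ^+ l)).
by rewrite aE.
Qed.

(** The antisymmetrised matrix units form a basis of the skew matrices, whose annihilator under the
    trace form is the space of symmetric matrices. *)
Definition annihilator_family
    (x : {p : 'I_n * 'I_n | (p.1 < p.2)%N} + {l : 'I_n | ~~ odd l}) : 'M[R]_n :=
  match x with
  | inl p => delta_mx (val p).1 (val p).2 - delta_mx (val p).2 (val p).1
  | inr l => N ^+ val l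
  end.

(** A relation has a skew part [A] and a symmetric part [B], which must vanish separately. *)
Lemma annihilator_family_free : mxfree annihilator_family.
Proof.
apply/mxfreeP => c; rewrite big_sumType /=.
set A := \sum_i _; set B := \sum_i _ => AB0.
have trA : A^T = - A.
  rewrite /A linear_sum /= -sumrN; apply: eq_bigr => p _.
  by rewrite linearZ linearB /= !trmx_delta -scalerN opprB.
have trB : B^T = B.
  rewrite /B linear_sum /=; apply: eq_bigr => l _.
  rewrite linearZ /= trmxX skewN exprNn -signr_odd (negPf (valP l)).
  by rewrite mul1r.
have A0 : A = 0.
  have e : A = B.
    have /(congr1 trmx) := AB0; rewrite linearD /= trA trB linear0.
    by move/eqP; rewrite addrC subr_eq0 => /eqP.
  by apply/eqP; move/eqP: AB0; rewrite -e -mulr2n -scaler_nat scalemx_eq0 pnatr_eq0.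
case=> [p|l].
  have := congr1 (fun Z : 'M_n => Z (val p).1 (val p).2) A0.
  rewrite summxE mxE (bigD1 p) //= big1 ?addr0 => [|q nq]; last first.
    rewrite !mxE; case: eqP => [e1|_] /=; last first.
      case: eqP => [e1|_] /=; last by rewrite subrr mulr0.
      case: eqP => [e2|_] /=; last by rewrite subrr mulr0.
      have lt_q := valP q; have lt_p := valP p; rewrite /= e1 e2 in lt_p.
      by have := ltn_trans lt_p lt_q; rewrite ltnn.
    case: eqP => [e2|_] /=; last first.
      case: eqP => [e3|_] /=; last by rewrite subrr mulr0.
      case: eqP => [e4|_] /=; last by rewrite subrr mulr0.
      by have lt_p := valP p; rewrite /= e1 e4 ltnn in lt_p.
    case/eqP: nq; apply: val_inj; rewrite [val p]surjective_pairing.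
    by rewrite [val q]surjective_pairing e1 e2.
  rewrite !mxE !eqxx /=; case: eqP => [e|_] /=; last by rewrite subr0 mulr1.
  by have := valP p; rewrite e ltnn.
move: AB0; rewrite A0 add0r.
have [a aE ea] := even_coef_extend (fun l => c (inr l)).
move=> /(etrans (esym ea)) B0; rewrite -aE; apply: skew_powers_free => //.
  exact: ltn_ord.
exact: (valP l).
Qed.

Lemma annihilator_familyP (D : 'M[R]_n) :
  (forall x, \tr (D *m annihilator_family x) = 0) <->
  (D^T = D /\ forall l, ~~ odd l -> (l <= n.-1)%N -> \tr (D *m N ^+ l) = 0).
Proof.
clear skewN sepN; have trE i j : \tr (D *m delta_mx i j) = D j i.
  rewrite /mxtrace (bigD1 j) //= big1 ?addr0 => [|k nk].
    rewrite mxE (bigD1 i) //= big1 ?addr0 => [|k nk]; first by rewrite mxE !eqxx mulr1.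
    by rewrite mxE (negPf nk) mulr0.
  by rewrite mxE big1 // => a _; rewrite mxE (negPf nk) andbF mulr0.
split=> [H|[symD trD]]; last first.
  case=> [p|l] /=; first by rewrite mulmxBr linearB /= !trE -{1}symD mxE subrr.
  by apply: trD; rewrite ?(valP l) // -ltnS (ltn_predK (ltn_ord (val l))).
have lt_sym (i j : 'I_n) : (i < j)%N -> D j i = D i j.
  move=> ij; have /= := H (inl (exist _ (i, j) ij)).
  by rewrite mulmxBr linearB /= !trE => /eqP; rewrite subr_eq0 => /eqP.
split.
  apply/matrixP => i j; rewrite mxE.
  by have [/lt_sym//|/lt_sym//|/val_inj ->] := ltngtP i j.
move=> l el le_ln; case: (ltnP l n) => [lt_ln|le_nl].
  exact: (H (inr (exist _ (Ordinal lt_ln) el))).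
(* The bound [l <= n.-1] lets [l = 0] through when [n = 0]; the trace is then an empty sum. *)
have n0 : n = 0%N by lia.
by rewrite /mxtrace big1 // => i; have := ltn_ord i; lia.
Qed.

End SkewTangent.

(** * Counting indices *)

Lemma card_ltn_pairs n : #|{: {p : 'I_n * 'I_n | (p.1 < p.2)%N}}| = 'C(n, 2).
Proof.
rewrite card_sig -sum1_card -bin2_sum big_mkord.
rewrite (eq_bigl (fun p : 'I_n * 'I_n => (p.1 < p.2)%N)) //.
rewrite -(pair_big_dep predT (fun i j : 'I_n => (i < j)%N) (fun _ _ => 1%N)) /=.
rewrite (exchange_big_dep predT) //=; apply: eq_bigr => j _.
by rewrite (big_ord_narrow (ltnW (ltn_ord j))) sum1_card card_ord.
Qed.

Lemma sum_even n : (\sum_(l < n | ~~ odd l) 1 = uphalf n)%N.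
Proof.
elim: n => [|n IH]; first by rewrite big_ord0.
rewrite big_mkcond big_ord_recr /= -big_mkcond IH /=.
by rewrite uphalf_half; case: (odd n) => /=; rewrite ?addn0 ?addn1.
Qed.

Lemma card_even_ord n : #|{: {l : 'I_n | ~~ odd l}}| = uphalf n.
Proof. by rewrite card_sig -sum1_card -sum_even; apply: eq_bigl. Qed.

Lemma sum_uphalf n : (\sum_(k < n) uphalf k = n ^ 2 %/ 4)%N.
Proof.
(* The cases n = 2h, with value h^2, and n = 2h + 1, with value h(h + 1), are proved together by
   induction on h. *)
have [e1 e2] : (\sum_(k < n./2.*2) uphalf k = n./2 ^ 2)%N
    /\ (\sum_(k < n./2.*2.+1) uphalf k = n./2 * n./2.+1)%N.
  elim: n./2 => [|m [_ IH]]; first by rewrite big_ord_recr !big_ord0.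
  have e : (\sum_(k < m.+1.*2) uphalf k = m.+1 ^ 2)%N.
    by rewrite doubleS big_ord_recr /= IH doubleK; nia.
  by split=> //; rewrite big_ord_recr /= e ?uphalf_double ?doubleK; nia.
move: e1 e2 (odd_double_half n); case: (odd n); move: n./2 => h e1 e2 <-.
  by rewrite add1n e2 -muln2; have := divn_eq (h * 2).+1.+1 1; nia.
by rewrite add0n e1 -muln2; nia.
Qed.

Lemma size_idxs n : size (idxs n) = (n ^ 2 %/ 4)%N.
Proof.
rewrite /idxs size_allpairs_dep sumnE big_map -sum_uphalf.
case: n => [|m]; first by rewrite big_nil big_ord0.
rewrite big_ord_recl [uphalf _]/= add0n.
rewrite (_ : iota 1 m.+1.-1 = index_iota 1 m.+1); last first.
  by rewrite /index_iota subn1.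
rewrite big_add1 big_mkord; apply: eq_bigr => k _.
rewrite size_filter -sum1_count (_ : minn k.+1.-1 m.+1.-2 = k); last first.
  by have := ltn_ord k; lia.
by rewrite -[RHS]sum_even -(big_mkord (fun l => ~~ odd l) (fun=> 1%N)) /index_iota subn0.
Qed.

Lemma mem_idxs n k l :
  ((k, l) \in idxs n) = [&& (l < k)%N, (k < n)%N & ~~ odd l].
Proof.
apply/allpairsPdep/idP => [[k' [l' [+ + [-> ->]]]]|/and3P[lt_lk lt_kn ev_l]].
  rewrite mem_iota mem_filter mem_iota => + /andP[-> +].
  by rewrite andbT; lia.
by exists k, l; split; rewrite // ?mem_filter mem_iota ?ev_l //=; lia.
Qed.

Lemma uniq_idxs n : uniq (idxs n).
Proof.
apply: allpairs_uniq_dep; rewrite ?iota_uniq //.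
  by move=> k _; rewrite filter_uniq // iota_uniq.
by move=> [k l] [k' l'] _ _ [-> ->].
Qed.

(** * Exponential loops in the twisted groups *)

Section ExponentialLoop.
Variables (R : realType) (n : nat).
Implicit Types b : 'M[R]_n.

(** The series exp(bz) when read in [LGplus], and exp(b/z) when read in [LGminus]. *)
Definition exp_pser b : pser R n := fun m => (m`!%:R)^-1 *: b ^+ m.

Lemma exp_pser0 b : exp_pser b 0 = 1%:M.
Proof. by rewrite /exp_pser fact0 invr1 scale1r. Qed.

Lemma exp_pser1 b : exp_pser b 1 = b.
Proof. by rewrite /exp_pser invr1 scale1r expr1. Qed.

Lemma mxscaleX (a : R) b k : (a *: b) ^+ k = a ^+ k *: b ^+ k.
Proof.
elim: k => [|k IH]; first by rewrite !expr0 scale1r.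
by rewrite !exprS IH !mulr_mx -scalemxAl -scalemxAr scalerA.
Qed.

Lemma exp_pserN b m : exp_pser (- b) m = (-1) ^+ m *: exp_pser b m.
Proof. by rewrite /exp_pser -scaleN1r mxscaleX !scalerA mulrC. Qed.

(** The binomial expansion of (1 - 1)^m, divided by m!. *)
Lemma sum_alternating_fact m :
  \sum_(i < m.+1) (i`!%:R)^-1 * ((-1) ^+ (m - i) * ((m - i)`!%:R)^-1)
    = (m == 0%N)%:R :> R.
Proof.
have fact_neq0 k : k`!%:R != 0 :> R by rewrite pnatr_eq0 -lt0n fact_gt0.
transitivity ((m`!%:R)^-1 * (-1 + 1) ^+ m : R); last first.
  by rewrite addNr expr0n; case: m => [|m]; rewrite ?mulr0 // fact0 invr1 mulr1.
rewrite exprDn mulr_sumr; apply: eq_bigr => i _.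
rewrite expr1n mulr1 -[_ *+ 'C(m, i)]mulr_natr.
have le_im : (i <= m)%N by rewrite -ltnS.
rewrite -[in RHS](bin_fact le_im) !natrM; field.
by rewrite !fact_neq0 pnatr_eq0 -lt0n bin_gt0 le_im.
Qed.

Lemma convp_exp b : convp (exp_pser b) (exp_pser (- b)) = pdelta R n.
Proof.
apply/funext => m; rewrite /convp /pdelta.
transitivity ((m == 0%N)%:R *: b ^+ m : 'M[R]_n); last first.
  by case: m => [|m]; rewrite ?scale1r ?scale0r.
rewrite -sum_alternating_fact scaler_suml; apply: eq_bigr => i _.
rewrite exp_pserN /exp_pser -scalemxAl -!scalemxAr !scalerA mulrA.
by congr (_ *: _); rewrite -[in RHS](subnKC (_ : (i <= m)%N)) ?exprD // -ltnS.
Qed.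

Lemma pinv_exp b : pinv (exp_pser b) (exp_pser (- b)).
Proof. by split; [|rewrite -{2}[b]opprK]; exact: convp_exp. Qed.

(** For symmetric [b], transposing the loop and changing the sign of z together invert it. *)
Lemma twisted_orth_exp b : b^T = b -> twisted_orth (exp_pser b).
Proof.
move=> symb m; rewrite -(convp_exp b); apply: eq_bigr => i _.
by rewrite exp_pserN -scalemxAr [exp_pser b (m - i)%N]/exp_pser linearZ /= trmxX symb.
Qed.

Lemma expR_ge_coeff (x : R) k : 0 <= x -> x ^+ k <= k`!%:R * expR x.
Proof.
move=> x0; case: k => [|k].
  by rewrite fact0 mul1r expr0 -(@expR0 R) ler_expR.
have k0 : 0 < k.+1`!%:R :> R by rewrite ltr0n fact_gt0.
rewrite mulrC -ler_pdivrMr // (le_trans _ (expR_ge1Dxn k x0)) //.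
by rewrite lerDr ler01.
Qed.

Lemma mxX_entry_bound b :
  exists2 c : R, 1 <= c & forall j i i', `|(b ^+ j) i i'| <= c ^+ j.
Proof.
exists (1 + \sum_i \sum_k `|b i k|).
  by rewrite lerDl; apply: sumr_ge0 => i _; apply: sumr_ge0.
elim=> [|j IH] i i'; first by rewrite !expr0 mxE; case: eqP => _; rewrite ?normr1 ?normr0.
set c : R := 1 + _ in IH *; have c0 : 0 <= c.
  by apply: addr_ge0 => //; apply: sumr_ge0 => k _; apply: sumr_ge0.
rewrite exprS mxE (le_trans (ler_norm_sum _ _ _)) //.
apply: (@le_trans _ _ (\sum_k `|b i k| * c ^+ j)).
  by apply: ler_sum => k _; rewrite normrM ler_wpM2l.
rewrite -mulr_suml exprS ler_wpM2r ?exprn_ge0 // /c [X in _ <= _ + X](bigD1 i) //=.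
rewrite addrCA lerDl; apply: addr_ge0 => //.
by apply: sumr_ge0 => k _; apply: sumr_ge0.
Qed.

Lemma rapid_exp b : rapid (exp_pser b).
Proof.
move=> p; have [c c1 bc] := mxX_entry_bound b.
have c0 : 0 <= c by exact: le_trans c1.
(* From j^p <= p! e^j and (c e)^j <= j! exp(c e), where c^j bounds the entries of [b ^+ j]. *)
exists (p`!%:R * expR (c * expR 1)) => j i i'.
have j0 : 0 < j`!%:R :> R by rewrite ltr0n fact_gt0.
rewrite mxE normrM ger0_norm ?invr_ge0 ?(ltW j0) // -mulrA ler_pdivrMl //.
apply: (@le_trans _ _ (c ^+ j * (p`!%:R * expR 1 ^+ j))).
  apply: ler_pM => //; first exact: exprn_ge0.
  by rewrite -expRM_natl mulr1 expR_ge_coeff.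
rewrite mulrCA [leRHS]mulrCA ler_pM2l ?ltr0n ?fact_gt0 //.
by rewrite -exprMn expR_ge_coeff // mulr_ge0 // expR_ge0.
Qed.

Lemma LGplus_exp b : b^T = b -> LGplus (exp_pser b).
Proof. by move=> symb; split; [exact: rapid_exp | exact: twisted_orth_exp]. Qed.

Lemma LGminus_exp b : b^T = b -> LGminus (exp_pser b).
Proof.
by move=> symb; split; [exact: rapid_exp | exact: exp_pser0 | exact: twisted_orth_exp].
Qed.

End ExponentialLoop.

(** * The coadjoint orbit as an affine space *)

Section CoadjointOrbit.
Variables (R : realType) (n : nat) (S0 N0 : 'M[R]_n).

(* Only the first coefficient of g_- matters: Pi_- kills the g_+ term, and
   g_-^{-1} (S0 + z N0) g_- = z N0 + S0 + [N0, g_{-,1}] + O(1/z). *)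
Lemma coadE gp hp gm hm : pinv gm hm -> gm 0%N = 1%:M ->
  coad S0 N0 gp hp gm hm = mk_loop (S0 + (N0 *m gm 1%N - gm 1%N *m N0)) N0.
Proof.
move=> [gh hg] gm0.
have hm0 : hm 0%N = 1%:M.
  have := congr1 (fun f => f 0%N) hg.
  by rewrite /convp /pdelta big_ord1 gm0 mulmx1.
have hm1 : hm 1%N = - gm 1%N.
  have := congr1 (fun f => f 1%N) hg.
  rewrite /convp /pdelta big_ord_recl big_ord1 /= gm0 hm0 mul1mx mulmx1.
  by move/eqP; rewrite addrC addr_eq0 => /eqP.
apply/funext => j; rewrite /coad /pminus /pplus /plusloop /minusloop1 /mk_loop.
case: j => [[|[|j]]|j] /=.
- rewrite add0r addn0 /convp !big_ord_recl !big_ord0 /= ?big_ord_recl ?big_ord0 /=.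
  rewrite /Aminus /= hm0 hm1 gm0 !mul1mx !mulmx1 !addr0 mulNmx.
  by rewrite addrCA addrA.
- by rewrite add0r subnn /convp !big_ord1 /Aminus hm0 gm0 mul1mx mulmx1.
- by rewrite addr0.
by rewrite addr0.
Qed.

Lemma coadj_orbitP X : coadj_orbit S0 N0 X <->
  exists2 b, b^T = b & X = mk_loop (S0 + (N0 *m b - b *m N0)) N0.
Proof.
split=> [[gp [hp [gm [hm [_ _ [_ gm0 gmo] gmh ->]]]]]|[b symb ->]].
  exists (gm 1%N); last exact: coadE.
  (* The coefficient of degree one in g(z) g(-z)^T = I says that the first coefficient of g_- is
     symmetric. *)
  have := gmo 1%N; rewrite /pdelta big_ord_recl big_ord1 /= gm0 trmx1.
  rewrite expr1 expr0 scale1r scaleN1r mul1mx mulmx1 => /eqP.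
  by rewrite addrC subr_eq0 => /eqP.
have sym0 : (0 : 'M[R]_n)^T = 0 by rewrite trmx0.
exists (exp_pser 0), (exp_pser (- 0)), (exp_pser b), (exp_pser (- b)).
split; [exact: LGplus_exp | exact: pinv_exp | exact: LGminus_exp | exact: pinv_exp|].
by rewrite coadE ?exp_pser1 //; [exact: pinv_exp | exact: exp_pser0].
Qed.

Hypotheses (skewN : N0^T = - N0) (sepN : simple_spectrum N0) (symS : S0^T = S0).

Lemma orbit_affP S : orbit_aff S0 N0 S <->
  exists2 b, b^T = b & S = S0 + (N0 *m b - b *m N0).
Proof.
split=> [[eS trS]|[b symb ->]].
  have [||b symb eb] := @skew_tangentP R n N0 skewN sepN (S - S0).
  - by rewrite linearB /= eS symS.
  - by move=> l el le_ln; rewrite mulmxBl linearB /= trS // subrr.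
  by exists b; rewrite // eb addrCA subrr addr0.
split.
  rewrite linearD linearB /= !trmx_mul symS symb skewN mulmxN mulNmx opprK.
  by rewrite addrC [- _ + _]addrC addrC.
by move=> l _ _; rewrite mulmxDl linearD /= mxtrace_commutatorX addr0.
Qed.

Lemma mk_loop_injl (S S' N N' : 'M[R]_n) : mk_loop S N = mk_loop S' N' -> S = S'.
Proof. by move/(congr1 (fun f => f 0)). Qed.

Lemma coadj_orbit_aff S : coadj_orbit S0 N0 (mk_loop S N0) <-> orbit_aff S0 N0 S.
Proof.
split=> [/coadj_orbitP[b symb /mk_loop_injl ->]|/orbit_affP[b symb ->]].
  by apply/orbit_affP; exists b.
by apply/coadj_orbitP; exists b.
Qed.

Lemma coadj_orbit_image : coadj_orbit S0 N0 = [set mk_loop S N0 | S in orbit_aff S0 N0].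
Proof.
apply/seteqP; split=> X /=.
  move/coadj_orbitP => [b symb ->]; eexists; last by [].
  by apply/orbit_affP; exists b.
by move=> [S oS <-]; apply/coadj_orbit_aff.
Qed.

(** The annihilating family has n(n-1)/2 skew members and as many even powers as there are even l <
    n; what is left of n^2 is 2[n^2/4] for either parity of n. *)
Lemma orbit_aff_dim : exists V : {vspace 'M[R]_n},
  \dim V = (n ^ 2 %/ 4)%N.*2 /\
  orbit_aff S0 N0 = [set S0 + B | B in [set B : 'M[R]_n | B \in V]].
Proof.
have [V dimV memV] := mx_annihilator (annihilator_family_free skewN sepN).
exists V; split.
  have := dimV; rewrite card_sum card_ltn_pairs card_even_ord bin2.
  move: (\dim V); have := odd_double_half n; case: (odd n); move: n./2 => h <- d.
    have -> : ((true + h.*2) * (true + h.*2).-1)./2 = ((true + h.*2) * h)%N.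
      by rewrite add1n /= -doubleMr doubleK.
    have -> : ((true + h.*2) ^ 2 %/ 4 = h * h.+1)%N by rewrite add1n -muln2; nia.
    by rewrite /= doubleK; nia.
  have -> : ((false + h.*2) * (false + h.*2).-1)./2 = (h * (h.*2).-1)%N.
    by rewrite add0n -doubleMl doubleK.
  have -> : ((false + h.*2) ^ 2 %/ 4 = h * h)%N by rewrite add0n -muln2; nia.
  by rewrite add0n uphalf_double; nia.
apply/seteqP; split=> S /=.
  move=> [eS trS]; exists (S - S0); last by rewrite addrCA subrr addr0.
  apply/memV/annihilator_familyP; split; first by rewrite linearB /= eS symS.
  by move=> l el le_ln; rewrite mulmxBl linearB /= trS // subrr.
move=> [B /memV/annihilator_familyP[symB trB] <-]; split.
  by rewrite linearD /= symS symB.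
by move=> l el le_ln; rewrite mulmxDl linearD /= trB // addr0.
Qed.

End CoadjointOrbit.

(** * Finite coefficient windows and Laurent coefficients of powers *)

Lemma pick_sidx (V : zmodType) K (f : int -> V) (a : int) :
  (absz a <= K)%N -> (forall j, j != a -> f j = 0) ->
  \sum_(i < K.*2.+1) f (sidx i) = f a.
Proof.
move=> le_aK f0; have lt_i : (absz (a + K%:Z)%R < K.*2.+1)%N by lia.
have e : sidx (Ordinal lt_i) = a by rewrite /sidx /=; lia.
rewrite (bigD1 (Ordinal lt_i)) //= e big1 ?addr0 // => i ni; apply: f0.
apply: contra_neq ni => ei; apply: val_inj => /=; rewrite -ei /sidx; lia.
Qed.

Lemma pick2_sidx (V : zmodType) K (f : int -> V) : (1 <= K)%N ->
  (forall j, j != 0 -> j != 1 -> f j = 0) ->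
  \sum_(i < K.*2.+1) f (sidx i) = f 0 + f 1.
Proof.
move=> K1 f0.
rewrite (eq_bigr (fun i => (if sidx i == 0 then f 0 else 0)
                           + (if sidx i == 1 then f 1 else 0))); last first.
  move=> i _; have [->|n0] := eqVneq (sidx i) 0; first by rewrite addr0.
  by have [->|n1] := eqVneq (sidx i) 1; rewrite add0r // f0.
rewrite big_split /=; congr (_ + _).
  rewrite (@pick_sidx _ K (fun j => if j == 0 then f 0 else 0) 0) // => j.
  by move/negPf->.
rewrite (@pick_sidx _ K (fun j => if j == 1 then f 1 else 0) 1) // => j.
by move/negPf->.
Qed.

Section LaurentCoefficients.
Variables (A : comNzRingType) (n : nat).
Implicit Types (Z : 'M[{poly A}]_n) (S N B : 'M[A]_n).

(** Polynomial matrices give powers of S + zN a ring structure and a cyclic trace; the extension by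
    0 to negative degrees matches the indexing of loops. *)
Definition coefmx Z (j : int) : 'M[A]_n :=
  if j is Posz l then map_mx (coefp l) Z else 0.

Definition linpoly_mx S N : 'M[{poly A}]_n := map_mx polyC S + 'X *: map_mx polyC N.

Definition psymz S N k (j : int) : 'M[A]_n := if j is Posz l then psym S N k l else 0.

Lemma coefmxD Z Z' j : coefmx (Z + Z') j = coefmx Z j + coefmx Z' j.
Proof.
case: j => l /=; rewrite ?addr0 //.
by apply/matrixP => a b; rewrite !mxE coefD.
Qed.

Lemma coefmxC B Z j : coefmx (map_mx polyC B *m Z) j = B *m coefmx Z j.
Proof.
case: j => l /=; rewrite ?mulmx0 //; apply/matrixP => a b; rewrite !mxE /= coef_sum.
by apply: eq_bigr => c _; rewrite !mxE coefCM.
Qed.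

Lemma coefmx_linpoly S N Z j :
  coefmx (linpoly_mx S N *m Z) j = S *m coefmx Z j + N *m coefmx Z (j - 1).
Proof.
rewrite mulmxDl coefmxD coefmxC; congr (_ + _).
rewrite -scalemxAl scalemxAr -coefmxC.
rewrite -scalemxAr; case: j => [[|l]|l] /=.
- by apply/matrixP => a b; rewrite !mxE coefXM.
- by rewrite subn1; apply/matrixP => a b; rewrite !mxE coefXM.
by [].
Qed.

Lemma coefmx_linpolyX S N k : coefmx (linpoly_mx S N ^+ k) = psymz S N k.
Proof.
elim: k => [|k IH]; apply/funext => j.
  case: j => [[|l]|l] //=; apply/matrixP => a b; rewrite !mxE /= coefMn coef1 //.
  by rewrite mul0rn.
rewrite exprS coefmx_linpoly IH; case: j => [[|l]|l] /=; rewrite ?mulmx0 ?addr0 //.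
by rewrite subn1.
Qed.

Lemma mxtrace_coefmx Z Z' (c : nat) j :
  \tr Z = \tr Z' *+ c -> \tr (coefmx Z j) = \tr (coefmx Z' j) *+ c.
Proof.
case: j => l /= e; last by rewrite mxtrace0 mul0rn.
rewrite /mxtrace (eq_bigr (fun i => (Z i i)`_l)) => [|i _]; last by rewrite mxE.
rewrite [in RHS](eq_bigr (fun i => (Z' i i)`_l)) => [|i _]; last by rewrite mxE.
by rewrite -!coef_sum -/(\tr Z) e coefMn.
Qed.

(* The derivative of (S + z N + e Y)^k at e = 0, for Y the constant loop B. *)
Fixpoint dpow_mx S N B k : 'M[{poly A}]_n :=
  if k is k'.+1 then
    map_mx polyC B *m linpoly_mx S N ^+ k' + linpoly_mx S N *m dpow_mx S N B k'
  else 0.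

(** By cyclicity of the trace all [k.+1] positions of [B] contribute equally; the left factor of
    exponent [m] is what the induction accumulates. *)
Lemma mxtrace_dpow S N B m k :
  \tr (linpoly_mx S N ^+ m *m dpow_mx S N B k.+1)
    = \tr (map_mx polyC B *m linpoly_mx S N ^+ (m + k)) *+ k.+1.
Proof.
set L := linpoly_mx S N; elim: k m => [|k IH] m.
  by rewrite /= mulmx0 addr0 expr0 mulmx1 mxtrace_mulC addn0.
rewrite [dpow_mx _ _ _ k.+2]/= -/L -/(dpow_mx S N B k.+1) mulmxDr linearD /=.
rewrite [X in _ + \tr X]mulmxA -[L ^+ m *m L]exprSr IH addSnnS [RHS]mulrS.
congr (_ + _); rewrite mxtrace_mulC -mulmxA; congr (\tr (_ *m _)).
by rewrite -[LHS]exprD addnC.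
Qed.

Lemma mxtrace_coef_dpow S N B k j :
  \tr (coefmx (dpow_mx S N B k.+1) j) = \tr (B *m psymz S N k j) *+ k.+1.
Proof.
rewrite -coefmx_linpolyX -coefmxC; apply: mxtrace_coefmx.
by have := mxtrace_dpow S N B 0 k; rewrite expr0 mul1mx.
Qed.

Lemma coef_dpowS S N B k j :
  coefmx (dpow_mx S N B k.+1) j = B *m psymz S N k j
    + (S *m coefmx (dpow_mx S N B k) j + N *m coefmx (dpow_mx S N B k) (j - 1)).
Proof. by rewrite /= coefmxD coefmxC coefmx_linpolyX coefmx_linpoly. Qed.

End LaurentCoefficients.

(** * Gradients of the Hamiltonians and nondegeneracy of the pairing *)

Section Gradient.
Variables (R : realType) (n : nat).
Implicit Types (S N D : 'M[R]_n) (X Y V W : loop R n).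

Lemma psymzS S N k j :
  psymz S N k.+1 j = S *m psymz S N k j + N *m psymz S N k (j - 1).
Proof. by rewrite -!coefmx_linpolyX exprS coefmx_linpoly. Qed.

Lemma lmul_mk_loop K S N Y j : (1 <= K)%N ->
  lmul K (mk_loop S N) Y j = S *m Y j + N *m Y (j - 1).
Proof.
move=> K1; rewrite /lmul.
rewrite (pick2_sidx (f := fun i => mk_loop S N i *m Y (j - i))) ?subr0 //.
by move=> i /negPf i0 /negPf i1; rewrite /mk_loop i0 i1 mul0mx.
Qed.

Lemma lpow_mk_loop K S N k : (1 <= K)%N -> lpow K (mk_loop S N) k = psymz S N k.
Proof.
move=> K1; elim: k => [|k IH]; apply/funext => j.
  by case: j => [[|l]|l].
by rewrite psymzS /= IH lmul_mk_loop.
Qed.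

Lemma lpair_mk_loop K S N Y : (1 <= K)%N ->
  lpair K (mk_loop S N) Y = \tr (S *m Y (-1)) + \tr (N *m Y (-2)).
Proof.
move=> K1; rewrite /lpair.
rewrite (pick2_sidx (f := fun i => \tr (mk_loop S N i *m Y (-1 - i)))) ?subr0 //.
by move=> i /negPf i0 /negPf i1; rewrite /mk_loop i0 i1 mul0mx mxtrace0.
Qed.

Lemma is_derive_sum_pt (I : Type) (r : seq I) (f : I -> R -> R) (df : I -> R) (x : R) :
  (forall i, is_derive x (1 : R) (f i) (df i)) ->
  is_derive x (1 : R) (fun e => \sum_(i <- r) f i e) (\sum_(i <- r) df i).
Proof.
move=> fd; elim: r => [|i r IH].
  rewrite big_nil (_ : (fun e => _) = (fun=> 0)); first exact: is_derive_cst.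
  by apply/funext => e; rewrite big_nil.
rewrite big_cons (_ : (fun e => _) = (fun e => f i e + \sum_(i <- r) f i e)).
  exact: (is_deriveD (fd i) IH).
by apply/funext => e; rewrite big_cons.
Qed.

Lemma is_derive_affine (p q x : R) :
  is_derive x (1 : R) (fun e : R => p + e * q) q.
Proof.
have H := is_deriveD (is_derive_cst p x (1 : R))
            (is_deriveM (is_derive_id x (1 : R)) (is_derive_cst q x (1 : R))).
by apply: (is_derive_eq H); rewrite scaler0 !add0r /GRing.scale /= mulr1.
Qed.

(** The derivative is linear in [Y], so each coefficient of [Y] is treated as a constant direction,
    contributing with the degree shifted by its index. *)
Lemma is_derive_lpow K S N Y k j a b : (1 <= K)%N ->
  is_derive (0 : R) (1 : R)
    (fun e : R => lpow K (fun j => mk_loop S N j + e *: Y j) k j a b)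
    ((\sum_(i < K.*2.+1) coefmx (dpow_mx S N (Y (sidx i)) k) (j - sidx i)) a b).
Proof.
move=> K1; elim: k j a b => [|k IH] j a b.
  rewrite summxE big1 /= => [|i _]; first exact: is_derive_cst.
  by case: (j - _) => l /=; rewrite !mxE ?coef0.
pose D k' j' := \sum_(i < K.*2.+1) coefmx (dpow_mx S N (Y (sidx i)) k') (j' - sidx i).
have eD : D k.+1 j = \sum_(i < K.*2.+1)
    (Y (sidx i) *m psymz S N k (j - sidx i) + mk_loop S N (sidx i) *m D k (j - sidx i)).
  rewrite big_split /= -[X in _ = _ + X]/(lmul K (mk_loop S N) (D k) j).
  rewrite lmul_mk_loop // /D !mulmx_sumr -!big_split /=; apply: eq_bigr => i _.
  by rewrite coef_dpowS addrAC.
rewrite -/(D k.+1 j) eD summxE.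
rewrite (_ : (fun e => _) = fun e : R => \sum_(i < K.*2.+1)
  \sum_c (mk_loop S N (sidx i) a c + e * Y (sidx i) a c)
     * lpow K (fun j => mk_loop S N j + e *: Y j) k (j - sidx i) c b); last first.
  apply/funext => e; rewrite /= /lmul summxE; apply: eq_bigr => i _.
  by rewrite mxE; apply: eq_bigr => c _; rewrite !mxE.
apply: is_derive_sum_pt => i; rewrite !mxE -big_split /=.
apply: is_derive_sum_pt => c.
have lin : is_derive (0 : R) (1 : R)
    (fun e : R => mk_loop S N (sidx i) a c + e * Y (sidx i) a c) (Y (sidx i) a c).
  exact: is_derive_affine.
have H := is_deriveM lin (IH (j - sidx i) c b).
apply: (is_derive_eq H); rewrite mul0r addr0.
rewrite (_ : (fun j => mk_loop S N j + 0 *: Y j) = mk_loop S N); last first.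
  by apply/funext => j'; rewrite scale0r addr0.
rewrite lpow_mk_loop // -/(D k (j - sidx i)) addrC /GRing.scale /=; congr (_ + _).
exact: mulrC.
Qed.

(** The loop z^(-l-1) (S + zN)^k. *)
Definition grad_Hkl S N k (l : int) : loop R n := fun m => psymz S N k (l + 1 + m).

Lemma is_derive_Hkl K S N Y k l : (1 <= K)%N ->
  is_derive (0 : R) (1 : R)
    (fun e : R => Hkl k l K (fun j => mk_loop S N j + e *: Y j))
    (lpair K Y (grad_Hkl S N k l)).
Proof.
move=> K1.
have H := is_deriveZ (k.+1%:R^-1 : R)
  (is_derive_sum_pt (index_enum 'I_n)
     (fun a => is_derive_lpow S N Y k.+1 l a a K1)).
apply: (is_derive_eq H).
rewrite -/(mxtrace (\sum_(i < K.*2.+1)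
  coefmx (dpow_mx S N (Y (sidx i)) k.+1) (l - sidx i))).
set T := \tr _; change ((k.+1%:R : R)^-1 * T = lpair K Y (grad_Hkl S N k l)).
rewrite /T linear_sum mulr_sumr; apply: eq_bigr => i _.
rewrite /= mxtrace_coef_dpow -[\tr _ *+ _]mulr_natl mulKf ?pnatr_eq0 // /grad_Hkl.
by congr (\tr (_ *m psymz _ _ _ _)); lia.
Qed.

Lemma psymz_tr S N k j : S^T = S -> N^T = - N ->
  (psymz S N k j)^T = if odd (absz j) then - psymz S N k j else psymz S N k j.
Proof.
move=> eS eN; case: j => l /=; last by rewrite trmx0 oppr0 if_same.
by rewrite psym_tr // -signr_odd; case: (odd l); rewrite ?scaleN1r ?scale1r.
Qed.

(** Extends [psym_comm] to all integers; at [l = -1] it says that [S ^+ k] commutes with [S]. *)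
Lemma psymz_comm S N k l :
  mcomm (psymz S N k (l + 1)) S = - mcomm (psymz S N k l) N.
Proof.
rewrite /mcomm; case: l => [l|[|l]] /=.
- by rewrite addn1; exact: psym_comm.
- by rewrite psym0 -[_ *m S]exprSr -[S *m _]exprS mul0mx mulmx0 !subrr oppr0.
by rewrite !mul0mx !mulmx0 subr0 oppr0.
Qed.

(** For even [l] the index [l + 1 + m] has parity opposite to [m], which turns the symmetry type of
    the dual into that of the algebra. *)
Lemma is_grad_Hkl S N k l : S^T = S -> N^T = - N -> ~~ odd (absz l) ->
  is_grad 1 (Hkl k l) (mk_loop S N) (grad_Hkl S N k l).
Proof.
move=> eS eN ev_l; split.
- move=> j; rewrite /grad_Hkl psymz_tr //.
  have -> : odd (absz (l + 1 + j)%R) = ~~ odd (absz j) by lia.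
  by case: (odd _).
- exists (k + absz l + 2)%N => j lt_j; rewrite /grad_Hkl.
  case e : (l + 1 + j) => [m|m] //=; apply: psym_small; lia.
by move=> K Y K1 _ _; exact: is_derive_Hkl.
Qed.

(** The pairing with S + zN sees only degrees -1 and -2 of the bracket. There the nonnegative parts
    contribute nothing, and a product of two negative parts starts at degree -2, with the product of
    the coefficients of degree -1. *)
Lemma lpair_lbrR K S N Y W : (1 <= K)%N ->
  lpair K (mk_loop S N) (lbrR K Y W) = - \tr (N *m mcomm (Y (-1)) (W (-1))).
Proof.
move=> K1; rewrite lpair_mk_loop //.
have plus0 (A B : loop R n) (j : int) : (j < 0)%R -> lmul K (pplus A) (pplus B) j = 0.
  move=> j0; apply: big1 => i _; rewrite /pplus.
  case: ifP => [i0|]; last by rewrite mul0mx.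
  by case: ifP => [ij|]; [lia | rewrite mulmx0].
have minus1 (A B : loop R n) : lmul K (pminus A) (pminus B) (-1) = 0.
  apply: big1 => i _; rewrite /pminus.
  case: ifP => [i0|]; last by rewrite mul0mx.
  by case: ifP => [ij|]; [lia | rewrite mulmx0].
have minus2 (A B : loop R n) : lmul K (pminus A) (pminus B) (-2) = A (-1) *m B (-1).
  rewrite /lmul (pick_sidx (f := fun i => pminus A i *m pminus B (-2 - i)) (a := -1)) //.
  move=> i ni; rewrite /pminus.
  case: ifP => [i0|]; last by rewrite mul0mx.
  by case: ifP => [ij|]; [lia | rewrite mulmx0].
rewrite /lbrR /lcomm !plus0 // !minus1 !minus2 !subr0 mulmx0 mxtrace0 add0r.
by rewrite sub0r mulmxN linearN.
Qed.

Lemma mxtrace_tr_mul_eq0 (Z : 'M[R]_n) : \tr (Z *m Z^T) = 0 -> Z = 0.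
Proof.
move=> trZ; apply/matrixP => i j; rewrite mxE.
have e : \tr (Z *m Z^T) = \sum_i \sum_j Z i j ^+ 2.
  by apply: eq_bigr => a _; rewrite mxE; apply: eq_bigr => b _; rewrite mxE expr2.
rewrite e in trZ.
have /psumr_eq0P /(_ trZ i isT) : forall i, true -> 0 <= \sum_j Z i j ^+ 2.
  by move=> a _; apply: sumr_ge0 => b _; exact: sqr_ge0.
have h a : true -> 0 <= Z i a ^+ 2 by move=> _; exact: sqr_ge0.
by move/(psumr_eq0P h)/(_ j isT)/eqP; rewrite sqrf_eq0 => /eqP.
Qed.

Definition loop_at (m : int) (A : 'M[R]_n) : loop R n := fun j => if j == m then A else 0.

Lemma lpair_atl K m A Y : (absz m <= K)%N ->
  lpair K (loop_at m A) Y = \tr (A *m Y (-1 - m)).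
Proof.
move=> le_mK; rewrite /lpair.
rewrite (pick_sidx (f := fun i => \tr (loop_at m A i *m Y (-1 - i))) (a := m)) //.
  by rewrite /loop_at eqxx.
by move=> j /negPf jm; rewrite /loop_at jm mul0mx mxtrace0.
Qed.

Lemma lpair_atr K m A Y : (absz (-1 - m)%R <= K)%N ->
  lpair K Y (loop_at m A) = \tr (Y (-1 - m) *m A).
Proof.
move=> le_mK; rewrite /lpair.
rewrite (pick_sidx (f := fun i => \tr (Y i *m loop_at m A (-1 - i))) (a := -1 - m)) //.
  by rewrite /loop_at (_ : _ == m) //; lia.
move=> j jm; rewrite /loop_at (_ : _ == m = false) ?mulmx0 ?mxtrace0 //; lia.
Qed.

(** Testing both gradients on the difference [Z] of their m-th coefficients, placed in the dual
    degree, gives tr(Z Z) = 0; as [Z] is symmetric or skew, this is tr(Z Z^T) = 0 up to sign. *)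
Lemma is_grad_unique KX F X W1 W2 :
  is_grad KX F X W1 -> is_grad KX F X W2 -> W1 = W2.
Proof.
move=> [a1 _ g1] [a2 _ g2]; apply/funext => m.
apply/eqP; rewrite -subr_eq0; apply/eqP; set Z := W1 m - W2 m.
have eZ : Z^T = if odd (absz m) then Z else - Z.
  by rewrite /Z linearB /= a1 a2; case: (odd _); rewrite // opprB opprK addrC.
pose Y := loop_at (-1 - m) Z; pose K := (KX + absz (-1 - m)%R)%N.
have symY : in_dual Y.
  move=> j; rewrite /Y /loop_at; case: eqP => [->|_]; last by rewrite trmx0 oppr0 if_same.
  rewrite eZ (_ : odd (absz (-1 - m)%R) = ~~ odd (absz m)); first by case: (odd _).
  by lia.
have supY : supp_in K Y.
  move=> j lt_K; rewrite /Y /loop_at; case: eqP => // ej.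
  by move: lt_K; rewrite ej /K ltnNge leq_addl.
have le_K : (KX <= K)%N by rewrite leq_addr.
have d1 := g1 K Y le_K supY symY; have d2 := g2 K Y le_K supY symY.
have := etrans (esym (derive_val (is_derive := d1))) (derive_val (is_derive := d2)).
rewrite !lpair_atl ?leq_addl // (_ : -1 - (-1 - m) = m); last by lia.
move/eqP; rewrite -subr_eq0 -linearB -mulmxBr -/Z => /eqP trZ.
apply: mxtrace_tr_mul_eq0; rewrite eZ; case: (odd _) => //.
by rewrite mulmxN linearN /= trZ oppr0.
Qed.

Lemma in_dual_unique K (V V' : loop R n) : in_dual V -> in_dual V' ->
  (forall Kb (Y : loop R n), (K <= Kb)%N -> supp_in Kb Y -> Defs.in_alg Y ->
     lpair Kb V Y = lpair Kb V' Y) -> V = V'.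
Proof.
move=> dV dV' H; apply/funext => m.
apply/eqP; rewrite -subr_eq0; apply/eqP; set Z := V m - V' m.
have eZ : Z^T = if odd (absz m) then - Z else Z.
  by rewrite /Z linearB /= dV dV'; case: (odd _); rewrite // opprB opprK addrC.
pose Y := loop_at (-1 - m) Z; pose Kb := (K + absz m + absz (-1 - m)%R)%N.
have algY : Defs.in_alg Y.
  move=> j; rewrite /Y /loop_at; case: eqP => [->|_]; last by rewrite trmx0 oppr0 if_same.
  rewrite eZ (_ : odd (absz (-1 - m)%R) = ~~ odd (absz m)); first by case: (odd _).
  by lia.
have supY : supp_in Kb Y.
  move=> j lt_K; rewrite /Y /loop_at; case: eqP => // ej.
  by move: lt_K; rewrite ej /Kb ltnNge leq_addl.
have := H Kb Y _ supY algY; rewrite /Kb -addnA leq_addr => /(_ isT).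
have em : -1 - (-1 - m) = m by lia.
rewrite !lpair_atr ?em; try by lia.
move/eqP; rewrite -subr_eq0 -linearB -mulmxBl -/Z => /eqP trZ.
apply: mxtrace_tr_mul_eq0; rewrite eZ; case: (odd _) => //.
by rewrite mulmxN linearN /= trZ oppr0.
Qed.

End Gradient.

(** * Hamiltonian vector fields and Poisson commutation *)

Lemma sum_words_psym (R : realType) n (S N : 'M[R]_n) k l :
  \sum_(w : k.-tuple bool | count id w == l)
     foldr (fun b P => (if b then N else S) *m P) 1%:M w = psym S N k l.
Proof.
elim: k l => [|k IH] l.
  rewrite big_mkcond (bigD1 [tuple]) //= big1 ?addr0 => [|w]; last by rewrite tuple0.
  by case: l.
pose cons_word (p : bool * k.-tuple bool) := [tuple of p.1 :: p.2].
rewrite (reindex cons_word) /=; last first.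
  exists (fun w => (thead w, [tuple of behead w])) => [[b w] _|w _].
    by congr pair; apply: val_inj.
  by rewrite [RHS]tuple_eta; apply: val_inj.
rewrite -(pair_big_dep predT
  (fun (b : bool) (w : k.-tuple bool) => (b + count id w)%N == l)
  (fun (b : bool) w => (if b then N else S) *m
     foldr (fun b P => (if b then N else S) *m P) 1%:M w)) /=.
rewrite big_bool /= -mulmx_sumr addrC; congr (_ + _).
  by rewrite -mulmx_sumr IH.
case: l => [|l]; first by rewrite big_pred0 // mulmx0.
by rewrite -IH.
Qed.

Section Hamiltonian.
Variables (R : realType) (n : nat).
Implicit Types (S N D : 'M[R]_n) (X Y V W : loop R n).

Lemma symz_psymz S N (k : nat) (l : int) : symz (k%:Z - l) l S N = psymz S N k l.
Proof.
case: l => l; last by rewrite /symz; case: (_ - _).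
have [le_lk|lt_kl] := leqP l k; last first.
  by rewrite /= psym_small //; case e : (_ - _) => [m|m] //=; lia.
have -> : k%:Z - Posz l = Posz (k - l)%N by lia.
by rewrite /= /symw sum_words_psym subnK.
Qed.

Lemma mcomm_tr_psymz S N k l : S^T = S -> N^T = - N -> ~~ odd (absz l) ->
  (mcomm (psymz S N k l) N)^T = mcomm (psymz S N k l) N.
Proof.
move=> eS eN ev_l; rewrite /mcomm linearB /= !trmx_mul psymz_tr // (negPf ev_l) eN.
by rewrite mulmxN mulNmx opprK addrC.
Qed.

Lemma in_dual_const (A : 'M[R]_n) : A^T = A -> in_dual (mk_loop A 0).
Proof.
move=> eA [[|[|j]]|j] //=; rewrite /mk_loop /= trmx0 ?oppr0 ?if_same //.
Qed.

Lemma mxtrace_mcomm (A B C : 'M[R]_n) : \tr (A *m mcomm B C) = \tr (B *m mcomm C A).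
Proof.
rewrite /mcomm !mulmxBr !linearB /= ; congr (_ - _).
  by rewrite mxtrace_mulC mulmxA.
by rewrite mulmxA mxtrace_mulC mulmxA mxtrace_mulC !mulmxA.
Qed.

(** [V0] satisfies the defining pairing identity by cyclicity of the trace; uniqueness of the
    gradient and nondegeneracy of the pairing leave no other solution. *)
Lemma is_hamvf_Hkl S N k l V : S^T = S -> N^T = - N -> ~~ odd (absz l) ->
  is_hamvf 1 (Hkl k l) (mk_loop S N) V <->
  V = mk_loop (- mcomm (psymz S N k l) N) 0.
Proof.
move=> eS eN ev_l; pose W := grad_Hkl S N k l.
have gradW := is_grad_Hkl k eS eN ev_l.
set V0 := mk_loop _ 0.
have dV0 : in_dual V0.
  by apply: in_dual_const; rewrite linearN /= mcomm_tr_psymz.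
have supV0 : supp_in 1 V0 by move=> [[|[|j]]|j].
have pairV0 K Y : (1 <= K)%N ->
    lpair K V0 Y = lpair K (mk_loop S N) (lbrR K Y W).
  move=> K1; rewrite lpair_lbrR // lpair_mk_loop // mul0mx mxtrace0 addr0.
  rewrite (mxtrace_mcomm N) mulNmx linearN /= mxtrace_mulC.
  by rewrite /W /grad_Hkl (_ : l + 1 - 1 = l) //; lia.
have [_ [KW supW] _] := gradW.
have supM K K' (Z : loop R n) : (K <= K')%N -> supp_in K Z -> supp_in K' Z.
  by move=> le_K supZ j lt_j; apply: supZ; exact: leq_ltn_trans lt_j.
split=> [[dV [KV supV] [W' [/is_grad_unique /(_ gradW) -> H]]]|->].
  apply: (in_dual_unique (K := (1 + KV + KW)%N)) dV dV0 _ => Kb Y le_K supY algY.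
  rewrite pairV0; last by lia.
  apply: H => //; first by lia.
    by apply: supM supV; lia.
  by apply: supM supW; lia.
split=> //; first by exists 1%N.
by exists W; split=> // K Y K1 _ _ _ _; exact: pairV0.
Qed.

Lemma mcommC (A B : 'M[R]_n) : mcomm A B = - mcomm B A.
Proof. by rewrite /mcomm opprB. Qed.

(* psymz_comm trades a commutator with N for one with S; used on both factors it
   moves (l, l') to (l - 1, l' + 1), and after l + 1 steps the first index is negative. *)
Lemma mxtrace_psymz_involution S N k k' l l' :
  \tr (N *m mcomm (psymz S N k l) (psymz S N k' l')) = 0.
Proof.
have step m m' : \tr (N *m mcomm (psymz S N k m) (psymz S N k' m'))
    = \tr (N *m mcomm (psymz S N k (m - 1)) (psymz S N k' (m' + 1))).
  set P := psymz S N k; set Q := psymz S N k'.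
  have trN (A B : 'M[R]_n) : \tr (A *m - B) = - \tr (A *m B).
    by rewrite mulmxN linearN.
  have eQ : mcomm (Q m') N = - mcomm (Q (m' + 1)) S by rewrite psymz_comm opprK.
  have eP : mcomm (P m) S = - mcomm (P (m - 1)) N.
    by rewrite -psymz_comm subrK.
  rewrite [LHS]mxtrace_mcomm eQ trN [in LHS]mxtrace_mcomm mcommC trN opprK eP trN.
  by rewrite -[in LHS]mxtrace_mcomm mcommC trN opprK.
case: l => [a|a]; last by rewrite /= /mcomm mul0mx mulmx0 subrr mulmx0 mxtrace0.
elim: a l' => [|a IH] l'; rewrite step.
  by rewrite /= /mcomm mul0mx mulmx0 subrr mulmx0 mxtrace0.
by rewrite (_ : Posz a.+1 - 1 = a) ?IH //; lia.
Qed.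

Lemma Hkl_poisson_commute S N k k' l l' K : (1 <= K)%N ->
  lpair K (mk_loop S N) (lbrR K (grad_Hkl S N k l) (grad_Hkl S N k' l')) = 0.
Proof. by move=> K1; rewrite lpair_lbrR // mxtrace_psymz_involution oppr0. Qed.

(** A direction along the orbit is a constant loop, so it pairs with the coefficient of degree -1 of
    the gradient. *)
Lemma dH_orbitE S N D k (l : nat) : dH_orbit N (k, l) S D = \tr (D *m psym S N k l).
Proof.
have H := @is_derive_Hkl R n 1 S N (mk_loop D 0) k l isT.
rewrite lpair_mk_loop // mul0mx mxtrace0 addr0 in H.
rewrite /dH_orbit /= derive1E.
rewrite (_ : (fun e : R => _) = (fun e : R => Hkl k l 1
    (fun j => mk_loop S N j + e *: mk_loop D 0 j))); last first.
  apply/funext => e; congr (Hkl _ _ _ _); apply/funext => -[[|[|j]]|j];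
  by rewrite /mk_loop /= ?scaler0 ?addr0.
rewrite (derive_val (is_derive := H)) /grad_Hkl.
by rewrite (_ : Posz l + 1 - 1 = Posz l) //; lia.
Qed.

End Hamiltonian.

(** * Independence of the differentials along the orbit *)

Section Independence.
Variables (R : realType) (n : nat) (S0 N0 : 'M[R]_n).
Hypotheses (skewN : N0^T = - N0) (sepN : simple_spectrum N0) (symS : S0^T = S0).

Lemma orbit_sym S : orbit_aff S0 N0 S -> S^T = S.
Proof. by case. Qed.

Lemma orbit_aff_add S D : orbit_aff S0 N0 S -> D^T = D ->
  (forall l, \tr (D *m N0 ^+ l) = 0) -> orbit_aff S0 N0 (S + D).
Proof.
move=> [eS trS] symD trD; split; first by rewrite linearD /= eS symD.
by move=> l el le_ln; rewrite mulmxDl linearD /= trD addr0 trS.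
Qed.

(** The point at [e = 1] already decides: a difference of two orbit points is a commutator of [N0]
    with a symmetric matrix, so it is orthogonal to every power of [N0]. *)
Lemma orbit_tangentP S D : orbit_aff S0 N0 S ->
  orbit_tangent S0 N0 S D <-> D^T = D /\ forall l, \tr (D *m N0 ^+ l) = 0.
Proof.
move=> oS; split=> [/(_ 1)|[symD trD] e].
  rewrite scale1r => /(coadj_orbit_aff skewN sepN symS).
  move/(orbit_affP skewN sepN symS) => [b symb eb].
  have [b' symb' eb'] := (orbit_affP skewN sepN symS S).1 oS.
  have eD : D = N0 *m (b - b') - (b - b') *m N0.
    apply: (addrI S); rewrite eb [in RHS]eb' -addrA mulmxBr mulmxBl; congr (_ + _).
    move: (N0 *m b) (b *m N0) (N0 *m b') (b' *m N0) => x y z w.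
    rewrite opprB [w - y]addrC (addrACA x) (addrCA (z - w)) [- z + w]addrC -[w - z]opprB.
    by rewrite subrr addr0.
  split; last by move=> l; rewrite eD mxtrace_commutatorX.
  rewrite eD linearB /= !trmx_mul linearB /= symb symb' skewN mulmxN mulNmx.
  by rewrite opprK addrC.
apply/(coadj_orbit_aff skewN sepN symS); apply: orbit_aff_add => //.
  by rewrite linearZ /= symD.
by move=> l; rewrite -scalemxAl linearZ /= trD mulr0.
Qed.

Lemma big_idxs (V : zmodType) (f : nat * nat -> V) :
  \sum_(p <- idxs n) f p
    = \sum_(x : 'I_n * 'I_n | psym_idx x && (x.1 != x.2)) f (val x.1, val x.2).
Proof.
pose g (x : 'I_n * 'I_n) : nat * nat := (val x.1, val x.2).
have gI : injective g by move=> [a b] [a' b'] [/val_inj -> /val_inj ->].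
rewrite -[RHS]big_filter -[RHS](big_map g predT f); apply: perm_big.
apply: uniq_perm; first exact: uniq_idxs.
  by rewrite map_inj_uniq // filter_uniq // index_enum_uniq.
case=> k l; rewrite mem_idxs; apply/idP/mapP => [/and3P[lt_lk lt_kn ev_l]|[[k' l']]].
  exists (Ordinal lt_kn, Ordinal (ltn_trans lt_lk lt_kn)) => //.
  rewrite mem_filter mem_index_enum andbT /psym_idx /= ltnW // ev_l /=.
  by rewrite -val_eqE /= gtn_eqF.
rewrite mem_filter /psym_idx -val_eqE /= => /andP[/andP[/andP[le_lk ev_l] nkl] _] [-> ->].
by rewrite ltn_ord ev_l ltn_neqAle le_lk eq_sym nkl.
Qed.

Lemma psym_sum_split S (c : nat * nat -> R) :
  \sum_(x : 'I_n * 'I_n | psym_idx x) c (val x.1, val x.2) *: psym S N0 x.1 x.2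
    = \sum_(p <- idxs n) c p *: psym S N0 p.1 p.2
      + \sum_(l < n | ~~ odd l) c (val l, val l) *: N0 ^+ l.
Proof.
rewrite (big_idxs (fun p => c p *: psym S N0 p.1 p.2)) (bigID (fun x => x.1 != x.2)) /=.
congr (_ + _); rewrite (reindex (fun l : 'I_n => (l, l))) /=; last first.
  by exists fst => [l|[a b]] //; rewrite inE /= negbK => /andP[_ /eqP ->].
by apply: eq_big => l; rewrite ?psym_diag // /psym_idx /= leqnn eqxx andbT.
Qed.

(* The orbit directions are exactly the orthogonal complement of the even powers of
   N0 (and of the skew matrices), so independence of the differentials along the orbit
   is independence of the gradients modulo those powers, which are psym k k. *)
Lemma indep_atP S : orbit_aff S0 N0 S ->
  indep_at S0 N0 S <-> mxfree (psym_family S N0).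
Proof.
move=> oS; have eS := orbit_sym oS.
have dHsum (c : nat * nat -> R) D : \sum_(p <- idxs n) c p * dH_orbit N0 p S D
    = \tr (D *m \sum_(p <- idxs n) c p *: psym S N0 p.1 p.2).
  rewrite mulmx_sumr raddf_sum; apply: eq_bigr => -[k l] _.
  by rewrite dH_orbitE /= -scalemxAr linearZ.
split=> [ind|/psym_freeP free].
  apply/psym_freeP => c' c'0.
  pose c (p : nat * nat) : R :=
    if insub p.1 is Some k then if insub p.2 is Some l then c' (k, l) else 0 else 0.
  have cE (x : 'I_n * 'I_n) : c (val x.1, val x.2) = c' x.
    by case: x => k l; rewrite /c /= !valK.
  have c0 : \sum_(x : 'I_n * 'I_n | psym_idx x)
      c (val x.1, val x.2) *: psym S N0 x.1 x.2 = 0.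
    by rewrite -[RHS]c'0; apply: eq_bigr => x _; rewrite cE.
  rewrite psym_sum_split in c0.
  (* By the relation, the part over [idxs n] is minus a combination of even powers of [N0], on which
     tangent directions vanish. *)
  have c_idx p : p \in idxs n -> c p = 0.
    apply: ind => D /(orbit_tangentP D oS)[_ trD].
    rewrite dHsum; move/eqP: c0; rewrite addr_eq0 => /eqP ->.
    have trN0 : \tr (D *m \sum_(l < n | ~~ odd l) c (val l, val l) *: N0 ^+ l) = 0.
      rewrite mulmx_sumr raddf_sum; apply: big1 => l _ /=.
      by rewrite -scalemxAr linearZ /= trD mulr0.
    by rewrite mulmxN linearN /= trN0 oppr0.
  rewrite big_seq big1 ?add0r in c0; last by move=> p /c_idx ->; rewrite scale0r.
  have c_diag := skew_powers_free (c := fun l => c (l, l)) skewN sepN c0.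
  move=> x idx_x; rewrite -cE; case: (eqVneq (val x.1) (val x.2)) => [e|ne].
    by rewrite e; apply: c_diag; [exact: ltn_ord | case/andP: idx_x].
  apply: c_idx; rewrite mem_idxs ltn_ord /=.
  by case/andP: idx_x => le_x ev_x; rewrite ltn_neqAle eq_sym ne le_x ev_x.
move=> c c0; pose Q := \sum_(p <- idxs n) c p *: psym S N0 p.1 p.2.
have symQ : Q^T = Q.
  rewrite /Q linear_sum /= big_seq [RHS]big_seq; apply: eq_bigr => -[k l].
  rewrite mem_idxs => /and3P[_ _ ev_l]; rewrite linearZ /= psym_tr //.
  by rewrite -signr_odd (negPf ev_l) scale1r.
(* [Q] is orthogonal to all tangent directions, hence lies in the span of the skew matrices and the
   even powers of [N0]; being symmetric, it has no skew component. *)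
have [|d eQ] := @mx_biorthogonal _ _ _ (@annihilator_family R n N0) Q.
  move=> D /annihilator_familyP[symD trD].
  have [b _ eb] := skew_tangentP skewN sepN symD trD.
  rewrite -dHsum; apply: c0; apply/(orbit_tangentP D oS); split=> // l.
  by rewrite -eb mxtrace_commutatorX.
have {d eQ} [a eQ] : exists a : nat -> R, Q = \sum_(l < n | ~~ odd l) a l *: N0 ^+ l.
  rewrite big_sumType /= in eQ; set A := \sum_i _ in eQ.
  have [a _ ea] := even_coef_extend N0 (fun l => d (inr l)).
  rewrite [X in _ = _ + X]ea in eQ; exists a; set B := \sum_(l < n | _) _ in eQ *.
  have trA : A^T = - A.
    rewrite /A linear_sum /= -sumrN; apply: eq_bigr => p _.
    by rewrite linearZ linearB /= !trmx_delta -scalerN opprB.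
  have trB : B^T = B.
    rewrite /B linear_sum /=; apply: eq_bigr => l ev_l.
    by rewrite linearZ /= trmxX skewN exprNn -signr_odd (negPf ev_l) mul1r.
  have : Q^T = - A + B by rewrite eQ linearD /= trA trB.
  rewrite symQ eQ => /addIr /eqP.
  rewrite -subr_eq0 opprK -mulr2n -scaler_nat scalemx_eq0 pnatr_eq0 /= => /eqP ->.
  by rewrite add0r.
(* Moving the powers of [N0] to the other side as the diagonal terms gives a relation in the whole
   [psym_family]. *)
pose c2 (p : nat * nat) := if p.1 == p.2 then - a p.2 else c p.
have c2_idx p : p \in idxs n -> c2 p = c p.
  by case: p => k l; rewrite mem_idxs /c2 /= => /and3P[lt_lk _ _]; rewrite gtn_eqF.
have c2_0 : \sum_(x : 'I_n * 'I_n | psym_idx x)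
    c2 (val x.1, val x.2) *: psym S N0 x.1 x.2 = 0.
  rewrite psym_sum_split big_seq (eq_bigr (fun p => c p *: psym S N0 p.1 p.2)).
    rewrite -big_seq -/Q eQ -big_split /= big1 // => l _.
    by rewrite /c2 /= eqxx scaleNr subrr.
  by move=> p /c2_idx ->.
move=> [k l] kl_idx; rewrite -c2_idx //.
have := kl_idx; rewrite mem_idxs => /and3P[lt_lk lt_kn ev_l].
apply: (free _ c2_0 (Ordinal lt_kn, Ordinal (ltn_trans lt_lk lt_kn))).
by rewrite /psym_idx /= ltnW.
Qed.

End Independence.

(** * Openness of independence *)

Section Openness.
Variables (R : realType) (n : nat).
Implicit Types (f g : 'M[R]_n -> R) (S N : 'M[R]_n).

Lemma continuous_sumr (I : finType) (f : I -> 'M[R]_n -> R) :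
  (forall i, continuous (f i)) -> continuous (fun S => \sum_i f i S).
Proof. by move=> fc; apply: continuous_big => //; exact: add_continuous. Qed.

Lemma continuous_prodr (I : finType) (f : I -> 'M[R]_n -> R) :
  (forall i, continuous (f i)) -> continuous (fun S => \prod_i f i S).
Proof. by move=> fc; apply: continuous_big => //; exact: mul_continuous. Qed.

Lemma continuous_mulr f g :
  continuous f -> continuous g -> continuous (fun S => f S * g S).
Proof. by move=> fc gc S; apply: continuousM; [exact: fc | exact: gc]. Qed.

Lemma continuous_psym N k l i j : continuous (fun S : 'M[R]_n => psym S N k l i j).
Proof.
elim: k l i j => [|k IH] l i j; first by move=> S; exact: cst_continuous.
have mulc c (g : 'M[R]_n -> R) : continuous g -> continuous (fun S => c * g S).
  by move=> gc; apply: continuous_mulr gc => S; exact: cst_continuous.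
have -> : (fun S => psym S N k.+1 l i j) = (fun S =>
    (\sum_c S i c * psym S N k l c j)
    + (if l is l'.+1 then \sum_c N i c * psym S N k l' c j else 0)).
  apply/funext => S; rewrite /= mxE mxE; congr (_ + _).
  by case: l => [|l]; rewrite mxE.
move=> S; apply: continuousD.
  apply: continuous_sumr => c; apply: continuous_mulr; last exact: IH.
  exact: coord_continuous.
case: l => [|l]; first exact: cst_continuous.
by apply: continuous_sumr => c; apply: mulc; exact: IH.
Qed.

(** A right inverse [B] at [S] is kept fixed; the determinant of the family times [B] is continuous
    and nonzero at [S], and wherever it is nonzero the family is free. *)
Lemma mxfree_psym_open S N : mxfree (psym_family S N) ->
  exists2 eps : R, 0 < eps & forall S' : 'M[R]_n,
    (forall i j, `|S' i j - S i j| < eps) -> mxfree (psym_family S' N).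
Proof.
move=> /row_freeP[B eB].
pose f (S' : 'M[R]_n) := \det (family_mx (psym_family S' N) *m B).
have entry_c i j : continuous (fun S' => (family_mx (psym_family S' N) *m B) i j).
  have -> : (fun S' => (family_mx (psym_family S' N) *m B) i j)
      = (fun S' => \sum_c family_mx (psym_family S' N) i c * B c j).
    by apply/funext => S'; rewrite mxE.
  apply: continuous_sumr => c; apply: continuous_mulr; last first.
    by move=> S'; exact: cst_continuous.
  case/mxvec_indexP: c => a b.
  have -> : (fun S' => family_mx (psym_family S' N) i (mxvec_index a b))
      = (fun S' => psym S' N (val (enum_val i)).1 (val (enum_val i)).2 a b).
    by apply/funext => S'; rewrite mxE mxvecE.
  exact: continuous_psym.
have fc : continuous f.
  apply: continuous_sumr => s; apply: continuous_mulr.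
    by move=> S'; exact: cst_continuous.
  by apply: continuous_prodr => i; exact: entry_c.
have : nbhs S [set S' | f S' != 0].
  have : nbhs (f S) [set x : R | x != 0].
    (* The radius is 1 because [f S] is the determinant of the identity. *)
    apply/nbhs_ballP; exists 1 => //= y; rewrite /f eB det1 /ball /=.
    by apply: contraTneq => ->; rewrite subr0 normr1 ltxx.
  exact: fc.
move=> /nbhs_ballP[eps /= eps0 ball_eps]; exists eps => // S' close.
have : f S' != 0.
  apply: ball_eps; split=> // i j; rewrite /ball /= distrC; exact: close.
rewrite /f -unitfE -unitmxE => uAB; apply/row_freeP.
by exists (B *m invmx (family_mx (psym_family S' N) *m B)); rewrite mulmxA mulmxV.
Qed.

End Openness.

Theorem theorem4p2 (R : realType) (n : nat) (S0 N0 : 'M[R]_n) :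
  N0^T = - N0 -> simple_spectrum N0 -> S0^T = S0 ->
  (* (a) the orbit is the affine space described, of dimension 2[n^2/4] *)
  (coadj_orbit S0 N0 = [set mk_loop S N0 | S in orbit_aff S0 N0] /\
   exists V : {vspace 'M[R]_n},
     \dim V = (n ^ 2 %/ 4)%N.*2 /\
     orbit_aff S0 N0 = [set S0 + B | B in [set B : 'M[R]_n | B \in V]]) /\
  (* (b) equations of motion of H_{k l} on loops S + z N *)
  (forall (k : nat) (l : int) (S N : 'M[R]_n),
     (1 <= k <= n)%N -> S^T = S -> N^T = - N ->
     mcomm (symz (k%:Z - (l + 1)) (l + 1) S N) S = - mcomm (symz (k%:Z - l) l S N) N /\
     (~~ odd (absz l) ->
        forall V, is_hamvf 1 (Hkl k l) (mk_loop S N) V <->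
                  V = mk_loop (mcomm (symz (k%:Z - (l + 1)) (l + 1) S N) S) 0)) /\
  (* [n^2/4] Hamiltonians ... *)
  size (idxs n) = (n ^ 2 %/ 4)%N /\
  (* ... which Poisson-commute on the orbit ... *)
  (forall p, p \in idxs n -> forall X, coadj_orbit S0 N0 X ->
     exists W, is_grad 1 (Hkl p.1 p.2%:Z) X W) /\
  (forall p q, p \in idxs n -> q \in idxs n -> forall X W1 W2,
     coadj_orbit S0 N0 X -> is_grad 1 (Hkl p.1 p.2%:Z) X W1 -> is_grad 1 (Hkl q.1 q.2%:Z) X W2 ->
     forall K : nat, (1 <= K)%N -> supp_in K W1 -> supp_in K W2 ->
       lpair K X (lbrR K W1 W2) = 0) /\
  (* ... and are generically independent on the orbit: the set of orbit points
     where their differentials along the orbit are independent is open and dense *)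
  (forall S, coadj_orbit S0 N0 (mk_loop S N0) -> forall eps : R, 0 < eps ->
     exists S', coadj_orbit S0 N0 (mk_loop S' N0) /\ indep_at S0 N0 S' /\
       forall i j, `|S' i j - S i j| < eps) /\
  (forall S, coadj_orbit S0 N0 (mk_loop S N0) -> indep_at S0 N0 S ->
     exists2 eps : R, 0 < eps & forall S', coadj_orbit S0 N0 (mk_loop S' N0) ->
       (forall i j, `|S' i j - S i j| < eps) -> indep_at S0 N0 S').
Proof.
move=> skewN sepN symS.
have orbitP := coadj_orbit_aff skewN sepN symS.
have onorbit X : coadj_orbit S0 N0 X -> exists2 S, X = mk_loop S N0 & S^T = S.
  rewrite coadj_orbit_image // => -[S [eS _] <-]; by exists S.
split; first by split; [exact: coadj_orbit_image | exact: orbit_aff_dim].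
split.
  move=> k l S N _ eS eN; rewrite !symz_psymz.
  split; first exact: psymz_comm.
  by move=> ev_l V; rewrite psymz_comm; exact: is_hamvf_Hkl.
split; first exact: size_idxs.
have grad S p : S^T = S -> p \in idxs n ->
    is_grad 1 (Hkl p.1 p.2%:Z) (mk_loop S N0) (grad_Hkl S N0 p.1 p.2).
  case: p => k l eS; rewrite mem_idxs => /and3P[_ _ ev_l].
  exact: is_grad_Hkl.
split.
  by move=> p p_idx X /onorbit[S -> eS]; eexists; exact: grad.
split.
  move=> p q p_idx q_idx X W1 W2 /onorbit[S -> eS].
  move=> /is_grad_unique /(_ (grad S p eS p_idx)) ->.
  move=> /is_grad_unique /(_ (grad S q eS q_idx)) -> K K1 _ _.
  exact: Hkl_poisson_commute.
split.
  move=> S /orbitP oS eps eps0.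
  have [D [symD trD freeD small]] := psym_free_dense S skewN sepN eps0.
  have oSD := orbit_aff_add oS symD trD.
  exists (S + D); split; first exact/orbitP.
  split; first exact/(indep_atP skewN sepN symS oSD).
  by move=> i j; rewrite mxE addrAC subrr add0r.
move=> S /orbitP oS /(indep_atP skewN sepN symS oS)/mxfree_psym_open[eps eps0 H].
exists eps => // S' /orbitP oS' close.
by apply/(indep_atP skewN sepN symS oS'); exact: H.
Qed.
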